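(* Work in $\mathbf{ZF}$. Let $(\mathbb K,|\cdot|)$ be a spherically complete ultrametric valued field. Then $\mathrm{I}_{(\mathbb K,|\cdot|)}$ and $\mathbf{LE}_{(\mathbb K,|\cdot|)}$ are equivalent, where $\mathrm{I}_{(\mathbb K,|\cdot|)}$: for every $\mathbb K$-vector space $E$ with an ultrametric vector semi-norm $p$, every vector subspace $F$ of $E$ and every linear $f:F\to\mathbb K$ with $|f(x)|\le p(x)$ for all $x\in F$, there exists a linear $\tilde f:E\to\mathbb K$ extending $f$ with $|\tilde f(x)|\le p(x)$ for all $x\in E$; $\mathbf{LE}_{(\mathbb K,|\cdot|)}$: for every vector subspace $F$ of an ultrametric semi-normed $\mathbb K$-vector space $(E,p)$, there exists an isometric linear extender $T:\mathrm{BL}(F,\mathbb K)\to\mathrm{BL}(E,\mathbb K)$.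
   Context: A valued field is ultrametric if $|x+y|\le\max(|x|,|y|)$; spherically complete if every chain of large balls $B(a,r)=\{x:|x-a|\le r\}$ has nonempty intersection. An ultrametric vector semi-norm on $E$ is $p:E\to\mathbb R_+$ with $p(0)=0$, $p(\lambda x)=|\lambda|p(x)$, $p(x+y)\le\max(p(x),p(y))$. For semi-normed spaces $(E,p)$, $(F,q)$, a linear $T:E\to F$ is bounded if $q(T(x))\le Mp(x)$ for some $M\in\mathbb R_+$ and all $x$; $\mathrm{BL}(E,F)$ is the space of bounded linear maps, with semi-norm $\|T\|=\inf\{M\ge0:\forall x\; q(T(x))\le Mp(x)\}$; $\mathbb K$ carries the semi-norm $|\cdot|$ and $F\subseteq E$ the restriction of $p$. An isometric linear extender is a continuous linear map $T:\mathrm{BL}(F,\mathbb K)\to\mathrm{BL}(E,\mathbb K)$ (for these operator semi-norms) such that for every $f\in\mathrm{BL}(F,\mathbb K)$, $T(f)$ extends $f$ and $\|T(f)\|=\|f\|$. *)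

(* Defs.v *)
From HB Require Import structures.
From mathcomp Require Import all_boot all_order all_algebra.
From mathcomp Require Import boolp classical_sets.

Set Implicit Arguments.
Unset Strict Implicit.
Unset Printing Implicit Defensive.

Import Order.TTheory GRing.Theory Num.Theory.
Local Open Scope classical_set_scope.
Local Open Scope ring_scope.

(* MathComp structures, on top of the type theory of Rocq.

   "Provable in ZF" is rendered as "true in every model of ZF". The models are
   first-order structures, and the separation and replacement schemes range
   over first-order formulas only: a choice principle of the metatheory
   (every MathComp structure carries a choice operator on its carrier) does not
   provide choice functions inside the model. The mathematical objects are
   MathComp structures whose carrier is identified with a set of the model, and
   every set or function that is quantified over has to be a set of the
   model ("internal"). *)

(** * Models of ZF *)

(* Formulas of the language of set theory, with de Bruijn indices. *)
Inductive formula : Type :=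
  | Mem of nat & nat
  | Eq of nat & nat
  | Neg of formula
  | And of formula & formula
  | All of formula.

Definition scons (V : Type) (v : V) (rho : nat -> V) : nat -> V :=
  fun i => if i is j.+1 then rho j else v.

Fixpoint sat (V : Type) (mem : V -> V -> Prop) (rho : nat -> V)
    (phi : formula) : Prop :=
  match phi with
  | Mem i j => mem (rho i) (rho j)
  | Eq i j => rho i = rho j
  | Neg phi1 => ~ sat mem rho phi1
  | And phi1 phi2 => sat mem rho phi1 /\ sat mem rho phi2
  | All phi1 => forall v : V, sat mem (scons v rho) phi1
  end.

Record zf_model : Type := ZFModel {
  zf_car :> Type;
  zf_in : zf_car -> zf_car -> Prop;
  zf_extensionality : forall a b : zf_car,
    (forall x, zf_in x a <-> zf_in x b) -> a = b;
  zf_foundation : forall a : zf_car, (exists x, zf_in x a) ->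
    exists2 x, zf_in x a & forall y, zf_in y x -> ~ zf_in y a;
  zf_pairing : forall a b : zf_car,
    exists c, forall x, zf_in x c <-> x = a \/ x = b;
  zf_union : forall a : zf_car,
    exists b, forall x, zf_in x b <-> exists2 y, zf_in y a & zf_in x y;
  zf_powerset : forall a : zf_car,
    exists b, forall x, zf_in x b <-> forall y, zf_in y x -> zf_in y a;
  zf_infinity : exists a : zf_car,
    (exists2 e, zf_in e a & forall x, ~ zf_in x e) /\
    (forall x, zf_in x a ->
      exists2 y, zf_in y a & forall z, zf_in z y <-> zf_in z x \/ z = x);
  zf_separation : forall (phi : formula) (rho : nat -> zf_car) (a : zf_car),
    exists b, forall x,
      zf_in x b <-> zf_in x a /\ sat zf_in (scons x rho) phi;
  zf_replacement : forall (phi : formula) (rho : nat -> zf_car) (a : zf_car),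
    (forall x y y', zf_in x a ->
      sat zf_in (scons x (scons y rho)) phi ->
      sat zf_in (scons x (scons y' rho)) phi -> y = y') ->
    exists b, forall y, zf_in y b <->
      exists2 x, zf_in x a & sat zf_in (scons x (scons y rho)) phi
}.

(** * Internal sets and functions *)

Section Codings.
Variable M : zf_model.

(* [c x v] reads "the set [v] of the model represents [x]"; an element of [X]
   need not be represented (a subset or a function which is not internal
   is not). *)
Definition coding (X : Type) : Type := X -> M -> Prop.

Definition is_upair (a b c : M) : Prop :=
  forall x, zf_in x c <-> x = a \/ x = b.

Definition is_opair (a b c : M) : Prop :=
  exists s t, [/\ is_upair a a s, is_upair a b t & is_upair s t c].

Definition pair_coding (X Y : Type) (cX : coding X) (cY : coding Y) :
    coding (X * Y) :=
  fun z v => exists a b, [/\ cX z.1 a, cY z.2 b & is_opair a b v].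

(* [v] is exactly the set of the representatives of the elements of [A], all of
   which are represented. *)
Definition set_coding (X : Type) (cX : coding X) : coding (set X) :=
  fun A v => (forall x, A x -> exists2 a, cX x a & zf_in a v) /\
             (forall a, zf_in a v -> exists2 x, A x & cX x a).

Definition fun_coding (X Y : Type) (cX : coding X) (cY : coding Y) :
    coding (X -> Y) :=
  fun f v => set_coding (pair_coding cX cY) [set (x, f x) | x in setT] v.

Definition internal (X : Type) (cX : coding X) (x : X) : Prop :=
  exists v, cX x v.

Definition internal_set (X : Type) (cX : coding X) (A : set X) : Prop :=
  internal (set_coding cX) A.

Definition internal_fun (X Y : Type) (cX : coding X) (cY : coding Y)
    (f : X -> Y) : Prop :=
  internal (fun_coding cX cY) f.

Definition internal_op (X Y Z : Type) (cX : coding X) (cY : coding Y)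
    (cZ : coding Z) (op : X -> Y -> Z) : Prop :=
  internal_fun (pair_coding cX cY) cZ (fun z => op z.1 z.2).

(* [cX] is a bijection between [X] and the elements of a set of the model. *)
Definition is_carrier (X : Type) (cX : coding X) : Prop :=
  [/\ (forall x v w, cX x v -> cX x w -> v = w),
      (forall x y v, cX x v -> cX y v -> x = y) &
      internal_set cX setT].

End Codings.

(** * Valued fields and semi-normed spaces of a model *)

(* The real line of the model: completeness only concerns internal subsets, so
   that [R] need not be a [realType]. *)
Definition is_real_line (M : zf_model) (R : realFieldType) (cR : coding M R) :
    Prop :=
  [/\ is_carrier cR,
      internal_op cR cR cR (fun x y : R => x + y),
      internal_op cR cR cR (fun x y : R => x * y),
      internal_set (pair_coding cR cR) [set z : R * R | z.1 <= z.2] &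
      forall A : set R, internal_set cR A -> has_sup A -> supremums A !=set0].

Definition is_internal_field (M : zf_model) (K : fieldType) (cK : coding M K) :
    Prop :=
  [/\ is_carrier cK,
      internal_op cK cK cK (fun x y : K => x + y) &
      internal_op cK cK cK (fun x y : K => x * y)].

Definition is_internal_space (M : zf_model) (K : fieldType) (cK : coding M K)
    (E : lmodType K) (cE : coding M E) : Prop :=
  [/\ is_carrier cE,
      internal_op cE cE cE (fun x y : E => x + y) &
      internal_op cK cE cE (fun (a : K) (x : E) => a *: x)].

Section Valued.
Variables (M : zf_model) (R : realFieldType) (cR : coding M R).
Variables (K : fieldType) (cK : coding M K) (av : K -> R).

Definition is_ultrametric_valued_field : Prop :=
  [/\ is_internal_field cK,
      internal_fun cK cR av,
      (forall x, 0 <= av x) /\ (forall x, av x = 0 <-> x = 0),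
      (forall x y, av (x * y) = av x * av y) &
      (forall x y, av (x + y) <= Num.max (av x) (av y))].

Definition large_ball (a : K) (r : R) : set K := [set x | av (x - a) <= r].

Definition spherically_complete : Prop :=
  forall C : set (set K), internal_set (set_coding cK) C ->
    (forall B, C B -> exists a r, 0 <= r /\ B = large_ball a r) ->
    (forall B B', C B -> C B' -> B `<=` B' \/ B' `<=` B) ->
    exists x, forall B, C B -> B x.

Definition is_ultrametric_seminorm (E : lmodType K) (cE : coding M E)
    (p : E -> R) : Prop :=
  [/\ internal_fun cE cR p,
      (forall x, 0 <= p x) /\ p 0 = 0,
      (forall a x, p (a *: x) = av a * p x) &
      (forall x y, p (x + y) <= Num.max (p x) (p y))].

(* BL(E, K), for E semi-normed by [p]. *)
Definition BL (E : lmodType K) (cE : coding M E) (p : E -> R) : set (E -> K) :=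
  [set f | [/\ scalar f, internal_fun cE cK f &
               exists2 m : R, 0 <= m & forall x, av (f x) <= m * p x]].

Definition opnorm (E : lmodType K) (p : E -> R) (f : E -> K) : R :=
  infimum 0 [set m : R | 0 <= m /\ forall x, av (f x) <= m * p x].

(* A vector subspace is a [subLmodType] [F] of [E], of internal membership
   predicate [P]; its elements are represented as elements of [E]. *)
Definition sub_coding (E : lmodType K) (cE : coding M E) (P : {pred E})
    (F : subLmodType P) : coding M F :=
  fun x => cE (val x).

Definition is_internal_pred (E : lmodType K) (cE : coding M E) (P : {pred E}) :
    Prop :=
  internal_set cE [set x | x \in P].

Definition Ingleton : Prop :=
  forall (E : lmodType K) (cE : coding M E) (p : E -> R),
    is_internal_space cK cE -> is_ultrametric_seminorm cE p ->
  forall (P : {pred E}) (F : subLmodType P), is_internal_pred cE P ->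
  forall f : {scalar F}, internal_fun (sub_coding cE (F := F)) cK f ->
    (forall x : F, av (f x) <= p (val x)) ->
  exists g : {scalar E},
    [/\ internal_fun cE cK g,
        forall x : F, g (val x) = f x &
        forall x : E, av (g x) <= p x].

Section Extender.
Variables (E : lmodType K) (cE : coding M E) (p : E -> R).
Variables (P : {pred E}) (F : subLmodType P).

Let cF : coding M F := sub_coding cE (F := F).
Let pF : F -> R := fun x => p (val x).
Let BLF : set (F -> K) := BL cF pF.
Let BLE : set (E -> K) := BL cE p.

(* The values of [T] outside of BL(F, K) are irrelevant. *)
Definition is_isometric_linear_extender (T : (F -> K) -> (E -> K)) : Prop :=
  [/\ internal_set (pair_coding (fun_coding cF cK) (fun_coding cE cK))
        [set (f, T f) | f in BLF],
      (forall f, BLF f -> BLE (T f)),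
      (forall (a : K) f g, BLF f -> BLF g ->
         T (fun y => a * f y + g y) = (fun x => a * T f x + T g x)),
      (forall f, BLF f -> forall e : R, 0 < e ->
         exists2 d : R, 0 < d & forall g, BLF g ->
           opnorm pF (g \- f) < d -> opnorm p (T g \- T f) < e) &
      (forall f, BLF f ->
         (forall x : F, T f (val x) = f x) /\
         opnorm p (T f) = opnorm pF f)].

End Extender.

Definition LinearExtender : Prop :=
  forall (E : lmodType K) (cE : coding M E) (p : E -> R),
    is_internal_space cK cE -> is_ultrametric_seminorm cE p ->
  forall (P : {pred E}) (F : subLmodType P), is_internal_pred cE P ->
  exists T : (F -> K) -> (E -> K), is_isometric_linear_extender cE p T.

End Valued.

(* Main.v *)
(* LE -> I: the extension [T f] has the norm of [f], which is at most 1.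

   I -> LE: call near projection a linear map Q from E to F, of norm at most 1,
   with p (Q (Q x) - Q x) = 0. Ingleton's property for a one-dimensional
   subspace shows that every near projection can be improved so as to fix one
   more vector of F (up to p-distance 0) without losing any; order near
   projections by the vectors they fix. For f in BL(F, K) and x in E, the
   function Q |-> f (Q x) is bounded by ||f|| p(x), bilinear in (f, x), and
   equal to f y on a dense open set of near projections if x = y is in F.
   Assigning to a function its constant value on a dense open set is a linear
   form of norm at most 1; extend it to a linear form L on all bounded functions
   by a single application of Ingleton's property, and let
   T f x = L (Q |-> f (Q x)).

   This works inside a model of ZF, possibly with nonstandard integers, because
   no finite sum and no choice of bases is involved. *)

Require Import Defs.
From mathcomp Require Import all_boot all_order all_algebra.
From HB Require Import structures.
From mathcomp Require Import boolp classical_sets functions.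

Set Implicit Arguments.
Unset Strict Implicit.
Unset Printing Implicit Defensive.

Import Order.TTheory GRing.Theory Num.Theory.
Local Open Scope classical_set_scope.

(** * First-order definability with parameters in a model of ZF *)

Section Definability.
Variable M : zf_model.

Lemma zf_inhabited : exists a : M, True.
Proof. by have [a _] := zf_infinity M; exists a. Qed.

Fixpoint rename (f : nat -> nat) (phi : formula) : formula :=
  match phi with
  | Defs.Mem i j => Defs.Mem (f i) (f j)
  | Eq i j => Eq (f i) (f j)
  | Neg phi1 => Neg (rename f phi1)
  | And phi1 phi2 => And (rename f phi1) (rename f phi2)
  | All phi1 => All (rename (fun i => if i is j.+1 then (f j).+1 else 0) phi1)
  end.

Lemma sat_rename (phi : formula) (f : nat -> nat) (rho : nat -> M) :
  sat (@zf_in M) rho (rename f phi) <-> sat (@zf_in M) (rho \o f) phi.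
Proof.
elim: phi f rho => [i j|i j|phi IH|phi1 IH1 phi2 IH2|phi IH] f rho //=.
- by split=> h /IH.
- by split=> -[/IH1 h1 /IH2 h2].
suff e v : scons v rho \o (fun i => if i is j.+1 then (f j).+1 else 0) =
    scons v (rho \o f).
  by split=> h v; [rewrite -e; apply/IH|apply/IH; rewrite e].
by apply/funext => -[].
Qed.

(** A single environment thus holds infinitely many variables and infinitely many parameters, so
    that combining formulas never exhausts the indices. *)
Definition interleave (rho sigma : nat -> M) : nat -> M :=
  fun i => if odd i then sigma i./2 else rho i./2.

Lemma interleave_var rho sigma i : interleave rho sigma i.*2 = rho i.
Proof. by rewrite /interleave odd_double doubleK. Qed.

Lemma interleave_cst rho sigma i : interleave rho sigma i.*2.+1 = sigma i.
Proof. by rewrite /interleave /= odd_double /= uphalf_double. Qed.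

(* Even indices of the formula are the variables, odd ones the parameters. *)
Definition dfn (Q : (nat -> M) -> Prop) : Prop :=
  exists phi sigma, forall rho,
    Q rho <-> sat (@zf_in M) (interleave rho sigma) phi.

Definition term (t : (nat -> M) -> M) : Prop :=
  (exists i, t = fun rho => rho i) \/ (exists c, t = fun=> c).

Lemma term_var i : term (fun rho => rho i).
Proof. by left; exists i. Qed.

Lemma term_cst c : term (fun=> c).
Proof. by right; exists c. Qed.

(** The parameter [c] is fixed before the place [j] that will hold it, so that several terms can
    share one [sigma]. A variable needs no parameter and gets an arbitrary [c]. *)
Lemma term_index t : term t -> exists c, forall sigma j, sigma j = c ->
  exists i, forall rho, t rho = interleave rho sigma i.
Proof.
case=> -[k ->].
  have [a _] := zf_inhabited; exists a => sigma _ _.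
  by exists k.*2 => rho; rewrite interleave_var.
by exists k => sigma j <-; exists j.*2.+1 => rho; rewrite interleave_cst.
Qed.

Lemma dfn_atom (r : M -> M -> Prop) (atom : nat -> nat -> formula) t s :
  (forall i j rho, sat (@zf_in M) rho (atom i j) <-> r (rho i) (rho j)) ->
  term t -> term s -> dfn (fun rho => r (t rho) (s rho)).
Proof.
move=> rE /term_index[c hc] /term_index[d hd].
pose sigma i := if i is 0 then c else d.
have [i hi] := hc sigma 0 erefl; have [j hj] := hd sigma 1 erefl.
by exists (atom i j), sigma => rho; rewrite rE hi hj.
Qed.

Lemma dfn_in t s : term t -> term s -> dfn (fun rho => zf_in (t rho) (s rho)).
Proof. exact: (dfn_atom (atom := Defs.Mem)). Qed.

Lemma dfn_eq t s : term t -> term s -> dfn (fun rho => t rho = s rho).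
Proof. exact: (dfn_atom (atom := Eq)). Qed.

Lemma dfn_not Q : dfn Q -> dfn (fun rho => ~ Q rho).
Proof.
by move=> [phi [sigma h]]; exists (Neg phi), sigma => rho /=; rewrite h.
Qed.

Lemma dfn_and Q1 Q2 : dfn Q1 -> dfn Q2 -> dfn (fun rho => Q1 rho /\ Q2 rho).
Proof.
move=> [phi1 [s1 h1]] [phi2 [s2 h2]].
(* Parameter [k] of [phi1] becomes parameter [2k] of the merged list, parameter [k] of [phi2]
   becomes [2k+1]; variables keep their indices. *)
pose f1 i := if odd i then i./2.*2.*2.+1 else i.
pose f2 i := if odd i then i./2.*2.+1.*2.+1 else i.
exists (And (rename f1 phi1) (rename f2 phi2)), (interleave s1 s2) => rho /=.
rewrite !sat_rename h1 h2.
suff [-> ->] : interleave rho (interleave s1 s2) \o f1 = interleave rho s1 /\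
  interleave rho (interleave s1 s2) \o f2 = interleave rho s2 by [].
split; apply/funext => i; rewrite /= /f1 /f2 {3}/interleave.
  by case: ifP => o; rewrite ?interleave_cst ?interleave_var// /interleave o.
by case: ifP => o; rewrite ?interleave_cst// /interleave o.
Qed.

Lemma dfn_all (Q : M -> (nat -> M) -> Prop) :
  dfn (fun rho => Q (rho 0) (fun i => rho i.+1)) ->
  dfn (fun rho => forall v, Q v rho).
Proof.
move=> [phi [sigma h]].
(* Variable 0 is the bound one and sits at index 0. Variable [j.+1] is variable [j] outside the
   binder, at index [2j], hence [2j+1] under it; parameters also move up by one. *)
pose f i := if odd i then i.+1 else if i./2 is j.+1 then j.*2.+1 else 0.
exists (All (rename f phi)), sigma => rho /=.
suff e v : scons v (interleave rho sigma) \o f = interleave (scons v rho) sigma.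
  by split=> hQ v; [rewrite sat_rename e -h; exact: hQ|
    have := hQ v; rewrite sat_rename e -h].
apply/funext => i; rewrite /= /f {2}/interleave.
case: ifP => [o|_]; first by rewrite /= /interleave o.
by case: i./2 => [|j] //=; rewrite interleave_var.
Qed.

Lemma dfn_iff Q Q' : (forall rho, Q rho <-> Q' rho) -> dfn Q -> dfn Q'.
Proof.
by move=> e [phi [sigma h]]; exists phi, sigma => rho; rewrite -e.
Qed.

Lemma dfn_imp Q1 Q2 : dfn Q1 -> dfn Q2 -> dfn (fun rho => Q1 rho -> Q2 rho).
Proof.
move=> h1 h2; apply: dfn_iff (dfn_not (dfn_and h1 (dfn_not h2))) => rho.
by split=> [h q1|h [q1]]; [apply: contrapT => q2; exact: h|apply; exact: h].
Qed.

Lemma dfn_or Q1 Q2 : dfn Q1 -> dfn Q2 -> dfn (fun rho => Q1 rho \/ Q2 rho).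
Proof.
move=> h1 h2; apply: dfn_iff (dfn_imp (dfn_not h1) h2) => rho.
by split=> [h|[]//]; have [q|q] := pselect (Q1 rho); [left|right; exact: h].
Qed.

Lemma dfn_equiv Q1 Q2 : dfn Q1 -> dfn Q2 -> dfn (fun rho => Q1 rho <-> Q2 rho).
Proof. by move=> h1 h2; apply: dfn_and; exact: dfn_imp. Qed.

Lemma dfn_ex (Q : M -> (nat -> M) -> Prop) :
  dfn (fun rho => Q (rho 0) (fun i => rho i.+1)) ->
  dfn (fun rho => exists v, Q v rho).
Proof.
move=> h; apply: dfn_iff (dfn_not (dfn_all (Q := fun v rho => ~ Q v rho)
  (dfn_not h))) => rho.
by split=> [nh|[v q] /(_ v)//]; apply: contrapT => /forallNP.
Qed.

Lemma dfn_ex2 (Q1 Q2 : M -> (nat -> M) -> Prop) :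
  dfn (fun rho => Q1 (rho 0) (fun i => rho i.+1)) ->
  dfn (fun rho => Q2 (rho 0) (fun i => rho i.+1)) ->
  dfn (fun rho => exists2 v, Q1 v rho & Q2 v rho).
Proof.
move=> h1 h2; apply: dfn_iff (dfn_ex (Q := fun v rho => Q1 v rho /\ Q2 v rho)
  (dfn_and h1 h2)) => rho.
by split=> -[v]; [case|]; exists v.
Qed.

Lemma dfn_and3 Q1 Q2 Q3 : dfn Q1 -> dfn Q2 -> dfn Q3 ->
  dfn (fun rho => [/\ Q1 rho, Q2 rho & Q3 rho]).
Proof.
move=> h1 h2 h3; apply: dfn_iff (dfn_and h1 (dfn_and h2 h3)) => rho.
by split=> [[? []]|[]].
Qed.

Lemma zf_comprehension (Q : M -> Prop) (a : M) :
  dfn (fun rho => Q (rho 0)) ->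
  exists b, forall x, zf_in x b <-> zf_in x a /\ Q x.
Proof.
move=> [phi [sigma h]].
(* Separation puts [x] at index 0 and the parameters after it. Since [Q] reads only [rho 0], all
   variables may be collapsed onto [x]. *)
pose f i := if odd i then i./2.+1 else 0.
have [b hb] := zf_separation (rename f phi) sigma a.
exists b => x; rewrite hb sat_rename (h (fun=> x)).
suff -> : scons x sigma \o f = interleave (fun=> x) sigma by [].
by apply/funext => i; rewrite /= /f /interleave; case: ifP.
Qed.

End Definability.

Ltac definable := cbv beta; lazymatch goal with
  | |- term _ => first [exact: term_var | exact: term_cst]
  | |- dfn (fun rho => _ /\ _) => apply: dfn_and; definable
  | |- dfn (fun rho => [/\ _, _ & _]) => apply: dfn_and3; definable
  | |- dfn (fun rho => _ <-> _) => apply: dfn_equiv; definable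
  | |- dfn (fun rho => _ \/ _) => apply: dfn_or; definable
  | |- dfn (fun rho => ~ _) => apply: dfn_not; definable
  | |- dfn (fun rho => exists2 _, _ & _) => apply: dfn_ex2; definable
  | |- dfn (fun rho => exists _, _) => apply: dfn_ex; definable
  | |- dfn (fun rho => zf_in _ _) => apply: dfn_in; definable
  | |- dfn (fun rho => _ = _) => apply: dfn_eq; definable
  | |- dfn (fun rho => is_opair _ _ _) => rewrite /is_opair; definable
  | |- dfn (fun rho => is_upair _ _ _) => rewrite /is_upair; definable
  | |- dfn (fun rho => forall _, _) =>
      first [apply: dfn_imp | apply: dfn_all]; definable
  end.

(** * Kuratowski pairs and Cartesian products in the model *)

Section OrderedPairs.
Variable M : zf_model.

Lemma upair_uniq (a b c c' : M) : is_upair a b c -> is_upair a b c' -> c = c'.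
Proof. by move=> h h'; apply: zf_extensionality => x; rewrite h h'. Qed.

Lemma opair_exists (a b : M) : exists c, is_opair a b c.
Proof.
have [s hs] := zf_pairing a a; have [t ht] := zf_pairing a b.
by have [c hc] := zf_pairing s t; exists c, s, t.
Qed.

Lemma opair_uniq (a b c c' : M) : is_opair a b c -> is_opair a b c' -> c = c'.
Proof.
move=> [s [t [hs ht hc]]] [s' [t' [hs' ht']]].
by rewrite -(upair_uniq hs hs') -(upair_uniq ht ht'); exact: upair_uniq.
Qed.

Lemma upair_inj (a b a' b' c : M) : is_upair a b c -> is_upair a' b' c ->
  (a = a' /\ b = b') \/ (a = b' /\ b = a').
Proof.
move=> h h'.
have /h' [] : zf_in a c by apply/h; left.
all: have /h' [] : zf_in b c by apply/h; right.
all: have /h [] : zf_in a' c by apply/h'; left.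
all: have /h [] : zf_in b' c by apply/h'; right.
all: by move=> *; subst; auto.
Qed.

Lemma opair_inj (a b a' b' c : M) :
  is_opair a b c -> is_opair a' b' c -> a = a' /\ b = b'.
Proof.
move=> [s [t [hs ht hc]]] [s' [t' [hs' ht' hc']]].
have [[? ?]|[? ?]] := upair_inj hc hc'; subst.
  have [[? _]|[? _]] := upair_inj hs hs'; subst.
    by have [[_ ?]|[? ?]] := upair_inj ht ht'; subst.
  by have [[_ ?]|[? ?]] := upair_inj ht ht'; subst.
(* The crossed case, where [{a} = {a', b'}] and [{a, b} = {a'}]: all four components coincide. *)
have [[? ?]|[? ?]] := upair_inj hs ht'; subst;
  by have [[? ?]|[? ?]] := upair_inj ht hs'; subst.
Qed.

(** Pairs are sets of subsets of the union of [a] and [b], so the product is separated from the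
    double power set of that union. *)
Lemma zf_product (a b : M) : exists c, forall z, zf_in z c <->
  exists x y, [/\ zf_in x a, zf_in y b & is_opair x y z].
Proof.
have [ab hab] := zf_pairing a b; have [u hu] := zf_union ab.
have [p hp] := zf_powerset u; have [pp hpp] := zf_powerset p.
have [c hc] := @zf_comprehension M
  (fun z => exists x y, [/\ zf_in x a, zf_in y b & is_opair x y z]) pp
  ltac:(definable).
exists c => z; rewrite hc; split=> [[]//|h]; split=> //.
have [x [y [xa yb [s [t [hs ht hz]]]]]] := h.
have xu : zf_in x u by apply/hu; exists a => //; apply/hab; left.
have yu : zf_in y u by apply/hu; exists b => //; apply/hab; right.
apply/hpp => w /hz [->|->]; apply/hp => v; first by move=> /hs [] ->.
by move=> /ht [] ->.
Qed.

End OrderedPairs.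

(** * Closure properties of internal sets and functions *)

Lemma sval_inj (T : Type) (P : T -> Prop) : injective (@sval T P).
Proof. by move=> [x px] [y py] /= e; exact: eq_exist. Qed.

(** Attaching the coding to the type lets the codings of products, function spaces and subtypes be
    composed as types are. *)
Record ctype (M : zf_model) := CType {
  csort :> Type;
  ccode : coding M csort;
  ccodeP : is_carrier ccode }.

Section InternalLogic.
Variable M : zf_model.
Implicit Types X Y Z : ctype M.

Lemma ccode_uniq X (x : X) a b : ccode x a -> ccode x b -> a = b.
Proof. by have [h _ _] := ccodeP X; apply: h. Qed.

Lemma ccode_inj X (x y : X) a : ccode x a -> ccode y a -> x = y.
Proof. by have [_ h _] := ccodeP X; apply: h. Qed.

Lemma ccode_exists X (x : X) : exists a, ccode x a.
Proof. by have [_ _ [v [/(_ x I) [a ? _] _]]] := ccodeP X; exists a. Qed.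

Lemma ccode_dom X : exists d, forall a, zf_in a d <-> exists x : X, ccode x a.
Proof.
have [_ _ [v [h1 h2]]] := ccodeP X; exists v => a; split.
  by move=> /h2 [x _ ?]; exists x.
by move=> [x xa]; have [b xb] := h1 x I; rewrite (ccode_uniq xa xb).
Qed.

Definition iset X (A : set X) := internal_set (@ccode _ X) A.

Definition ifun X Y (f : X -> Y) := internal_fun (@ccode _ X) (@ccode _ Y) f.

(** Separation inside the set of all representatives of [X] turns a definable condition on codes
    into an internal subset. *)
Lemma iset_of_dfn X (A : set X) (Q : M -> Prop) :
  dfn (fun rho : nat -> M => Q (rho 0)) ->
  (forall x a, ccode x a -> (A x <-> Q a)) -> iset A.
Proof.
move=> Qd AQ; have [d hd] := ccode_dom X.
have [v hv] := zf_comprehension d Qd.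
exists v; split=> [x Ax|a /hv [/hd [x xa] Qa]].
  have [a xa] := ccode_exists x; exists a => //; apply/hv; split.
    by apply/hd; exists x.
  exact/(AQ _ _ xa).
by exists x => //; apply/(AQ _ _ xa).
Qed.

Lemma iset_codes X (A : set X) : iset A ->
  exists v, forall x a, ccode x a -> (A x <-> zf_in a v).
Proof.
move=> [v [h1 h2]]; exists v => x a xa; split=> [/h1 [b xb]|/h2 [y Ay ya]].
  by rewrite (ccode_uniq xa xb).
by rewrite (ccode_inj xa ya).
Qed.

Lemma pair_coding_carrier X Y :
  is_carrier (pair_coding (@ccode _ X) (@ccode _ Y)).
Proof.
split.
- move=> [x y] v w [a [b [xa yb hv]]] [a' [b' [xa' yb' hw]]].
  rewrite -(ccode_uniq xa xa') -(ccode_uniq yb yb') in hw.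
  exact: opair_uniq hv hw.
- move=> [x y] [x' y'] v [a [b [/= xa yb hv]]] [a' [b' [/= xa' yb' hw]]].
  have [? ?] := opair_inj hv hw; subst.
  by rewrite (ccode_inj xa xa') (ccode_inj yb yb').
have [c hc] := ccode_dom X; have [d hd] := ccode_dom Y.
have [e he] := zf_product c d.
exists e; split=> [[x y] _|v /he [a [b [/hc [x xa] /hd [y yb] hv]]]].
  have [a xa] := ccode_exists x; have [b yb] := ccode_exists y.
  have [v hv] := opair_exists a b; exists v; first by exists a, b.
  by apply/he; exists a, b; split; [apply/hc; exists x|apply/hd; exists y|].
by exists (x, y) => //; exists a, b.
Qed.

Definition cprod X Y := CType (@pair_coding_carrier X Y).

Lemma ccode_prod X Y (x : X) (y : Y) a b c : ccode x a -> ccode y b ->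
  @ccode _ (cprod X Y) (x, y) c <-> is_opair a b c.
Proof.
move=> xa yb; split=> [[a' [b' [/= xa' yb' h]]]|h]; last by exists a, b.
by rewrite (ccode_uniq xa xa') (ccode_uniq yb yb').
Qed.

Lemma iset_ext X (A B : set X) : (forall x, A x <-> B x) -> iset A -> iset B.
Proof.
by move=> AB; rewrite (_ : A = B)//; apply/funext => x; exact/propext.
Qed.

Lemma iset_and X (A B : set X) : iset A -> iset B -> iset (fun x => A x /\ B x).
Proof.
move=> /iset_codes[v hv] /iset_codes[w hw].
apply: (@iset_of_dfn _ _ (fun a => zf_in a v /\ zf_in a w)).
  by definable.
by move=> x a xa; rewrite (hv _ _ xa) (hw _ _ xa).
Qed.

Lemma iset_not X (A : set X) : iset A -> iset (fun x => ~ A x).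
Proof.
move=> /iset_codes[v hv]; apply: (@iset_of_dfn _ _ (fun a => ~ zf_in a v)).
  by definable.
by move=> x a xa; rewrite (hv _ _ xa).
Qed.

Lemma iset_imp X (A B : set X) :
  iset A -> iset B -> iset (fun x => A x -> B x).
Proof.
move=> hA hB; apply: iset_ext (iset_not (iset_and hA (iset_not hB))) => x.
by split=> [h q1|h [q1]]; [apply: contrapT => q2; exact: h|apply; exact: h].
Qed.

(** A quantifier over the external type [Y] is a quantifier over the elements of the set [d] of its
    codes, hence first-order. *)
Lemma iset_ex X Y (A : X -> Y -> Prop) :
  @iset (cprod X Y) (fun z => A z.1 z.2) -> iset (fun x => exists y, A x y).
Proof.
move=> /iset_codes[v hv]; have [d hd] := ccode_dom Y.
apply: (@iset_of_dfn _ _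
  (fun a => exists2 b, zf_in b d & exists2 c, is_opair a b c & zf_in c v)).
  by definable.
move=> x a xa; split=> [[y Axy]|[b /hd[y yb] [c abc cv]]].
  have [b yb] := ccode_exists y; exists b; first by apply/hd; exists y.
  have [c abc] := opair_exists a b; exists c => //.
  by apply/(hv (x, y)) => //; exact/(ccode_prod _ xa yb).
by exists y; apply/(hv (x, y) c) => //; exact/(ccode_prod _ xa yb).
Qed.

Lemma iset_all X Y (A : X -> Y -> Prop) :
  @iset (cprod X Y) (fun z => A z.1 z.2) -> iset (fun x => forall y, A x y).
Proof.
move=> h; apply: iset_ext (iset_not (iset_ex (A := fun x y => ~ A x y)
  (iset_not h))) => x.
split=> [nh y|h' [y] /(_ (h' y))//].
by apply: contrapT => nA; apply: nh; exists y.
Qed.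

Lemma ifun_graphP X Y (f : X -> Y) :
  ifun f <-> @iset (cprod X Y) (fun z => z.2 = f z.1).
Proof.
rewrite /ifun /internal_fun /iset /internal_set /internal /fun_coding.
suff -> : [set (x, f x) | x in setT] = (fun z : X * Y => z.2 = f z.1) by [].
apply/funext => -[x y]; apply/propext; split=> [[_ _ [<- <-//]]|/= ->].
by exists x.
Qed.

Lemma ifun_codes X Y (f : X -> Y) : ifun f ->
  exists v, forall x a y b, ccode x a -> ccode y b ->
    (y = f x <-> exists2 c, is_opair a b c & zf_in c v).
Proof.
move=> /ifun_graphP/iset_codes[v hv]; exists v => x a y b xa yb.
split=> [e|[c abc]]; last first.
  by move/(hv (x, y)); apply; exact/(ccode_prod _ xa yb).
have [c abc] := opair_exists a b; exists c => //.
by apply/(hv (x, y)) => //; exact/(ccode_prod _ xa yb).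
Qed.

Lemma ifun_of_dfn X Y (f : X -> Y) (Q : M -> M -> Prop) :
  dfn (fun rho : nat -> M => Q (rho 0) (rho 1)) ->
  (forall x a y b, ccode x a -> ccode y b -> (y = f x <-> Q a b)) -> ifun f.
Proof.
move=> Qd fQ; apply/ifun_graphP.
apply: (@iset_of_dfn _ _ (fun c => exists a b, is_opair a b c /\ Q a b)).
  apply: (@dfn_ex _ (fun a rho => exists b, is_opair a b (rho 0) /\ Q a b)).
  apply: (@dfn_ex _
    (fun b rho => is_opair (rho 0) b (rho 1) /\ Q (rho 0) b)).
  apply: dfn_and; first by definable.
  (* After both quantifiers [b] is variable 0 and [a] is variable 1, the opposite of the order in
     [Qd]; the formula is renamed by the transposition [swap]. *)
  move: Qd => [phi [sigma h]].
  pose swap (T : Type) (u : nat -> T) i :=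
    if i is 0 then u 1 else if i is 1 then u 0 else u i.
  pose f1 i := if odd i then i else swap _ double i./2.
  exists (rename f1 phi), sigma => rho; rewrite sat_rename (h (swap _ rho)).
  suff -> : interleave rho sigma \o f1 = interleave (swap _ rho) sigma by [].
  apply/funext => i; rewrite /= /f1.
  have [oi|/negbTE oi] := boolP (odd i); rewrite /interleave oi ?oi//.
  have sw u k : odd (swap _ double k) = false /\
      u (swap _ double k)./2 = swap M u k.
    by case: k => [|[|k]]; rewrite /swap ?odd_double ?doubleK.
  by have [-> ->] := sw rho i./2.
move=> [x y] c [a [b [/= xa yb abc]]]; rewrite (fQ _ _ _ _ xa yb); split.
  by move=> q; exists a, b.
by move=> [a' [b' [abc' q]]]; have [-> ->] := opair_inj abc abc'.
Qed.

Lemma ifun_cst X Y (y0 : Y) : @ifun X Y (fun=> y0).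
Proof.
have [b0 yb0] := ccode_exists y0.
apply: (@ifun_of_dfn _ _ _ (fun _ b => b = b0)); first by definable.
move=> x a y b xa yb; split=> [e|e].
  by subst; exact: ccode_uniq yb yb0.
by subst; exact: ccode_inj yb yb0.
Qed.

Lemma ifun_id X : @ifun X X (fun x => x).
Proof.
apply: (@ifun_of_dfn _ _ _ (fun a b => b = a)); first by definable.
move=> x a y b xa yb; split=> e; subst.
  by apply: ccode_uniq yb xa.
by apply: ccode_inj yb xa.
Qed.

Lemma ifun_comp Y Z (g : Y -> Z) (hg : ifun g) X (f : X -> Y) :
  ifun f -> ifun (fun x => g (f x)).
Proof.
move: hg => /ifun_codes[w hw] /ifun_codes[v hv].
have [d hd] := ccode_dom Y.
apply: (@ifun_of_dfn _ _ _ (fun a c => exists b, [/\ zf_in b d,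
  (exists2 e, is_opair a b e & zf_in e v) &
  (exists2 e, is_opair b c e & zf_in e w)])); first by definable.
move=> x a z c xa zc; split=> [e|[b [/hd [y yb] h1 h2]]].
  subst z.
  have [b yb] := ccode_exists (f x); exists b; split.
  - by apply/hd; exists (f x).
  - exact/(hv _ _ _ _ xa yb).
  - by apply/(hw _ _ _ _ yb zc).
by rewrite ((hw _ _ _ _ yb zc).2 h2) ((hv _ _ _ _ xa yb).2 h1).
Qed.

Lemma iset_preim X Y (f : X -> Y) (A : set Y) :
  ifun f -> iset A -> iset (fun x => A (f x)).
Proof.
move=> /ifun_codes[v hv] /iset_codes[w hw].
have [d hd] := ccode_dom Y.
apply: (@iset_of_dfn _ _ (fun a => exists b, [/\ zf_in b d,
  (exists2 e, is_opair a b e & zf_in e v) & zf_in b w])); first by definable.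
move=> x a xa; split=> [Af|[b [/hd [y yb] h1 h2]]].
  have [b yb] := ccode_exists (f x); exists b; split.
  - by apply/hd; exists (f x).
  - exact/(hv _ _ _ _ xa yb).
  - by apply/(hw _ _ yb).
by rewrite -((hv _ _ _ _ xa yb).2 h1); apply/(hw _ _ yb).
Qed.

Lemma ifun_fst X Y : @ifun (cprod X Y) X (fun z => z.1).
Proof.
have [d hd] := ccode_dom Y.
apply: (@ifun_of_dfn _ _ _ (fun c a => exists b, is_opair a b c)).
  by definable.
move=> [x y] c x' a [a' [b [/= xa yb abc]]] xa'; split=> [e|[b']].
  by subst; exists b; rewrite (ccode_uniq xa' xa).
by move=> /(opair_inj abc) [e _]; subst; apply: ccode_inj xa' xa.
Qed.

Lemma ifun_snd X Y : @ifun (cprod X Y) Y (fun z => z.2).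
Proof.
apply: (@ifun_of_dfn _ _ _ (fun c b => exists a, is_opair a b c)).
  by definable.
move=> [x y] c y' b [a [b' [/= xa yb abc]]] yb'; split=> [e|[a']].
  by subst; exists a; rewrite (ccode_uniq yb' yb).
by move=> /(opair_inj abc) [_ e]; subst; apply: ccode_inj yb' yb.
Qed.

Lemma ifun_fst_comp X Y Z (f : Z -> cprod X Y) :
  ifun f -> ifun (fun z => (f z).1).
Proof. exact: (ifun_comp (@ifun_fst X Y)). Qed.

Lemma ifun_snd_comp X Y Z (f : Z -> cprod X Y) :
  ifun f -> ifun (fun z => (f z).2).
Proof. exact: (ifun_comp (@ifun_snd X Y)). Qed.

Lemma ifun_pair X Y Z (f : X -> Y) (g : X -> Z) :
  ifun f -> ifun g -> @ifun X (cprod Y Z) (fun x => (f x, g x)).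
Proof.
move=> /ifun_codes[v hv] /ifun_codes[w hw].
apply: (@ifun_of_dfn _ _ _ (fun a c => exists b b', [/\ is_opair b b' c,
  (exists2 e, is_opair a b e & zf_in e v) &
  (exists2 e, is_opair a b' e & zf_in e w)])); first by definable.
move=> x a [y z] c xa [b [b' [/= yb zb bc]]]; split.
  move=> [e1 e2]; exists b, b'; split=> //.
    exact/(hv _ _ _ _ xa yb).
  exact/(hw _ _ _ _ xa zb).
move=> [b1 [b2 [/(opair_inj bc) [<- <-]]]].
by move=> /(hv _ _ _ _ xa yb) <- /(hw _ _ _ _ xa zb) <-.
Qed.

Lemma iset_diag X : @iset (cprod X X) (fun z => z.1 = z.2).
Proof.
apply: iset_ext ((ifun_graphP _).1 (ifun_id X)) => -[x y] /=.
by split=> ->.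
Qed.

Lemma iset_eq X Y (f g : X -> Y) : ifun f -> ifun g ->
  iset (fun x => f x = g x).
Proof.
by move=> hf hg; exact: (iset_preim (ifun_pair hf hg) (@iset_diag Y)).
Qed.

Lemma ifun_comp2 X Y Z (g : X -> Y -> Z)
    (hg : @ifun (cprod X Y) Z (fun z => g z.1 z.2))
    (T : ctype M) (f : T -> X) (f' : T -> Y) :
  ifun f -> ifun f' -> ifun (fun t => g (f t) (f' t)).
Proof. by move=> hf hf'; exact: (ifun_comp hg (ifun_pair hf hf')). Qed.

Lemma iset_comp2 X Y (A : X -> Y -> Prop)
    (hA : @iset (cprod X Y) (fun z => A z.1 z.2))
    (T : ctype M) (f : T -> X) (f' : T -> Y) :
  ifun f -> ifun f' -> iset (fun t => A (f t) (f' t)).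
Proof. by move=> hf hf'; exact: (iset_preim (ifun_pair hf hf') hA). Qed.

(** * The carrier of internal functions; evaluation and currying *)

Section FunctionSpace.
Variables X Y : ctype M.

Definition cfun_coding : coding M {f : X -> Y | ifun f} :=
  fun f => fun_coding (@ccode _ X) (@ccode _ Y) (sval f).

Lemma cfun_codingP (f : {f : X -> Y | ifun f}) v : cfun_coding f v ->
  forall x a y b, ccode x a -> ccode y b ->
    (y = sval f x <-> exists2 c, is_opair a b c & zf_in c v).
Proof.
move=> [h1 h2] x a y b xa yb; split=> [e|[c abc /h2[_ [x' _ <-]]]].
  have [c xyc cv] := h1 (x, y) ltac:(by exists x; rewrite // e).
  by exists c => //; exact/(ccode_prod _ xa yb).
move=> [a' [b' [/= xa' yb' /(opair_inj abc) [? ?]]]]; subst.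
by rewrite (ccode_inj xa xa') (ccode_inj yb yb').
Qed.

(** The codes are the functional subsets of the product of the two domains, separated from its power
    set. *)
Lemma cfun_coding_carrier : is_carrier cfun_coding.
Proof.
have [d hd] := ccode_dom X; have [e he] := ccode_dom Y.
split.
- move=> f v w [h1 h2] [h3 h4]; apply: zf_extensionality => c.
  split=> [/h2 [z fz zc]|/h4 [z fz zc]].
    have [c' zc'] := h3 _ fz.
    by rewrite (@ccode_uniq (cprod X Y) _ _ _ zc zc').
  have [c' zc'] := h1 _ fz.
  by rewrite (@ccode_uniq (cprod X Y) _ _ _ zc zc').
- move=> f g v hf hg; apply: sval_inj; apply/funext => x.
  have [a xa] := ccode_exists x; have [b yb] := ccode_exists (sval f x).
  by apply/(cfun_codingP hg xa yb)/(cfun_codingP hf xa yb).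
have [p hp] := zf_product d e; have [pp hpp] := zf_powerset p.
have [s hs] := @zf_comprehension M (fun v => forall a, zf_in a d ->
  exists2 b, (exists2 c, is_opair a b c & zf_in c v) &
  forall b', (exists2 c, is_opair a b' c & zf_in c v) -> b' = b) pp
  ltac:(definable).
exists s; split=> [f _|v /hs [/hpp vp hv]].
  have [v fv] := svalP f; exists v => //; apply/hs; split.
    apply/hpp => c /(proj2 fv) [[x y] _ [a [b [xa yb abc]]]].
    apply/hp; exists a, b.
    by split=> //; [apply/hd; exists x|apply/he; exists y].
  move=> a /hd [x xa]; have [b yb] := ccode_exists (sval f x).
  exists b; first exact/(cfun_codingP (f := f) fv xa yb).
  move=> b' [c ab'c cv].
  have /hp [a1 [b1 [_ /he [y yb'] ab1c]]] : zf_in c p.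
    apply/hp; have [[x1 y1] _ [a1 [b1 [xa1 yb1 h]]]] := (proj2 fv) _ cv.
    by exists a1, b1; split=> //; [apply/hd; exists x1|apply/he; exists y1].
  have [_ ?] := opair_inj ab'c ab1c; subst b1.
  have ey : y = sval f x.
    by apply/(cfun_codingP (f := f) fv xa yb'); exists c.
  by subst y; exact: ccode_uniq yb' yb.
have key (x : X) : exists y : Y, forall a b, ccode x a -> ccode y b ->
    exists2 c, is_opair a b c & zf_in c v.
  have [a xa] := ccode_exists x.
  have [b [c abc cv] _] := hv a ltac:(by apply/hd; exists x).
  have /hp [a1 [b1 [_ /he [y yb] ab1c]]] := vp _ cv.
  have [_ ?] := opair_inj abc ab1c; subst b1.
  exists y => a' b' xa' yb'.
  by exists c => //; rewrite (ccode_uniq xa' xa) (ccode_uniq yb' yb).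
(* [choice] acts outside the model. Values are unique, so [f] is forced, and it is internal because
   its graph is the given set [v]. *)
have [f hf] := choice key.
have fv : fun_coding (@ccode _ X) (@ccode _ Y) f v.
  split=> [_ [x _ <-]|c cv].
    have [a xa] := ccode_exists x; have [b yb] := ccode_exists (f x).
    have [c abc cv] := hf _ _ _ xa yb.
    by exists c => //; exists a, b.
  have /hp [a [b [/hd [x xa] /he [y yb] abc]]] := vp _ cv.
  exists (x, y); last by exists a, b.
  exists x => //; congr pair.
  have [b' yb'] := ccode_exists (f x).
  have [b0 _ hb0] := hv a ltac:(by apply/hd; exists x).
  have ? : b = b0 by apply: hb0; exists c.
  have ? : b' = b0 by apply: hb0; exact: hf xa yb'.
  by subst; apply: ccode_inj yb' yb.
by exists (exist _ f (ex_intro _ v fv)).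
Qed.

Definition cfun := CType cfun_coding_carrier.

Lemma ifun_eval : @ifun (cprod cfun X) Y (fun z => sval z.1 z.2).
Proof.
apply: (@ifun_of_dfn _ _ _ (fun d b => exists v a, is_opair v a d /\
  exists2 c, is_opair a b c & zf_in c v)); first by definable.
move=> [f x] d y b [v [a [/= fv xa hd]]] yb; split.
  by move=> /(cfun_codingP fv xa yb) h; exists v, a.
move=> [v' [a' [/(opair_inj hd) [<- <-]]]].
by move=> /(cfun_codingP fv xa yb).
Qed.

End FunctionSpace.

Lemma ifun_app X Y Z (f : Z -> cfun X Y) (g : Z -> X) : ifun f -> ifun g ->
  ifun (fun z => sval (f z) (g z)).
Proof. exact: (ifun_comp2 (@ifun_eval X Y)). Qed.

(** By extensionality [g = f z] means agreement at every [x], so the graph of [f] is given by a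
    quantifier over [X]. *)
Lemma ifun_lam X Y Z (f : Z -> cfun X Y) :
  @ifun (cprod Z X) Y (fun z => sval (f z.1) z.2) -> ifun f.
Proof.
move=> h; apply/ifun_graphP.
apply: (@iset_ext (cprod Z (cfun X Y))
    (fun w => forall x, sval w.2 x = sval (f w.1) x)).
  move=> [z g] /=; split=> [e|-> //]; apply: sval_inj; exact/funext.
apply: iset_all; apply: iset_eq.
  apply: ifun_app; last exact: ifun_snd.
  exact: ifun_comp (@ifun_snd _ _) _ _ (@ifun_fst _ _).
apply: (ifun_comp2 (g := fun z x => sval (f z) x) h); last exact: ifun_snd.
exact: ifun_comp (@ifun_fst _ _) _ _ (@ifun_fst _ _).
Qed.

(** * Types that embed in a carrier with internal image *)

Section Subtype.
Variables (X : ctype M) (U : Type) (v : U -> X).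
Hypotheses (v_inj : injective v) (v_im : iset (fun x => exists u, x = v u)).

(** An element is coded by its image. This makes carriers of the subspace [F], the near projections,
    the bounded functions and [BL(F, K)]. *)
Lemma csub_carrier : is_carrier (fun u => ccode (v u)).
Proof.
split=> [u a b|u1 u2 a h1 h2|]; first exact: ccode_uniq.
  by apply: v_inj; exact: ccode_inj h1 h2.
have [w [h1 h2]] := v_im; exists w; split=> [u _|a /h2 [_ [u ->] ua]].
  by apply: h1; exists u.
by exists u.
Qed.

Definition csub := CType csub_carrier.

Lemma ifun_val : @ifun csub X v.
Proof.
apply: (@ifun_of_dfn _ _ _ (fun a b => b = a)); first by definable.
move=> u a y b ua yb; split=> e; subst.
  by apply: ccode_uniq yb ua.
by apply: ccode_inj yb ua.
Qed.

Lemma ifun_sub Z (f : Z -> U) : ifun (fun z => v (f z)) -> @ifun Z csub f.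
Proof.
move=> h; apply/ifun_graphP.
apply: (@iset_ext (cprod Z csub) (fun w => v w.2 = v (f w.1))).
  by move=> [z u] /=; split=> [/v_inj|->].
apply: iset_eq; first exact: (ifun_comp ifun_val (@ifun_snd _ _)).
exact: (ifun_comp h (@ifun_fst _ _)).
Qed.

End Subtype.

End InternalLogic.

(** A hook for [solve_ifun], redefined once the operations of the space and the field are known to
    be internal. *)
Ltac ifun_op := fail.

Ltac solve_ifun := repeat (cbv beta; first
  [ exact: ifun_id | exact: ifun_fst | exact: ifun_snd | exact: ifun_cst
  | ifun_op | apply: ifun_fst_comp | apply: ifun_snd_comp ]).

Local Open Scope ring_scope.

(** * Vector subspaces given by propositional predicates, turned into [subLmodType] structures *)

Record submodule (K : fieldType) (E : lmodType K) := Submodule {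
  sm_pred : E -> Prop;
  sm_0 : sm_pred 0;
  sm_lin : forall a x y, sm_pred x -> sm_pred y -> sm_pred (a *: x + y) }.

Section SubmoduleType.
Variables (K : fieldType) (E : lmodType K) (S : submodule E).

Definition sm_mem : {pred E} := fun x => `[< sm_pred S x >].

Lemma sm_mem_closed : submod_closed sm_mem.
Proof.
split=> [|a x y /asboolP hx /asboolP hy]; apply/asboolP; first exact: sm_0.
exact: sm_lin.
Qed.

HB.instance Definition _ :=
  GRing.isSubmodClosed.Build K E sm_mem sm_mem_closed.

Definition sm_type : Type := {x : E | sm_mem x}.
HB.instance Definition _ := SubChoice.on sm_type.
HB.instance Definition _ := [SubChoice_isSubLmodule of sm_type by <:].

Lemma sm_valP (x : sm_type) : sm_pred S (val x).
Proof. exact/asboolP/(valP x). Qed.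

Lemma sm_mk (x : E) : sm_pred S x -> exists u : sm_type, val u = x.
Proof. by move=> /asboolP h; exists (exist _ x h). Qed.

End SubmoduleType.

(** * The valued field, the real line of the model and operator norms *)

Section ValuedField.
Variables (M : zf_model) (R : realFieldType) (cR : coding M R).
Variables (K : fieldType) (cK : coding M K) (av : K -> R).
Hypotheses (hR : is_real_line cR) (hK : is_ultrametric_valued_field cR cK av).

Lemma real_line_carrier : is_carrier cR. Proof. by case: hR. Qed.
Lemma valued_field_carrier : is_carrier cK. Proof. by case: hK => -[]. Qed.

Let RC := CType real_line_carrier.
Let KC := CType valued_field_carrier.

Lemma av_ge0 x : 0 <= av x. Proof. by case: hK => _ _ []. Qed.
Lemma av0_eq0 x : av x = 0 -> x = 0.
Proof. by case: hK => _ _ [_ h] _ _ /h. Qed.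
Lemma av0 : av 0 = 0. Proof. by case: hK => _ _ [_ h] _ _; apply/h. Qed.
Lemma avM x y : av (x * y) = av x * av y. Proof. by case: hK. Qed.
Lemma avD x y : av (x + y) <= Num.max (av x) (av y). Proof. by case: hK. Qed.

Lemma av1 : av 1 = 1.
Proof.
have /mulfI h : av 1 != 0 by apply/eqP => /av0_eq0/eqP; rewrite oner_eq0.
by apply: h; rewrite -avM !mulr1.
Qed.

Lemma ifun_av (T : ctype M) (f : T -> KC) :
  ifun f -> @ifun _ T RC (fun t => av (f t)).
Proof.
have h : @ifun _ KC RC av by case: hK.
by move=> hf; exact: (ifun_comp h hf).
Qed.

Lemma ifun_mulR (T : ctype M) (f g : T -> RC) :
  ifun f -> ifun g -> @ifun _ T RC (fun t => f t * g t).
Proof.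
have h : @ifun _ (cprod RC RC) RC (fun z => z.1 * z.2) by case: hR.
exact: (@ifun_comp2 _ RC RC RC (fun x y => x * y) h).
Qed.

Lemma ifun_addK (T : ctype M) (f g : T -> KC) :
  ifun f -> ifun g -> @ifun _ T KC (fun t => f t + g t).
Proof.
have h : @ifun _ (cprod KC KC) KC (fun z => z.1 + z.2) by case: hK => -[].
exact: (@ifun_comp2 _ KC KC KC (fun x y => x + y) h).
Qed.

Lemma ifun_mulK (T : ctype M) (f g : T -> KC) :
  ifun f -> ifun g -> @ifun _ T KC (fun t => f t * g t).
Proof.
have h : @ifun _ (cprod KC KC) KC (fun z => z.1 * z.2) by case: hK => -[].
exact: (@ifun_comp2 _ KC KC KC (fun x y => x * y) h).
Qed.

Lemma iset_le (T : ctype M) (f g : T -> RC) :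
  ifun f -> ifun g -> @iset _ T (fun t => f t <= g t).
Proof.
have h : @iset _ (cprod RC RC) (fun z => z.1 <= z.2) by case: hR.
exact: (@iset_comp2 _ RC RC (fun x y => x <= y) h).
Qed.

Lemma real_line_sup (A : set R) : @iset _ RC A -> A !=set0 ->
  (exists m, forall x, A x -> x <= m) ->
  exists s, (forall x, A x -> x <= s) /\
    forall m, (forall x, A x -> x <= m) -> s <= m.
Proof.
move=> hA A0 [m hm]; have [_ _ _ _ /(_ A hA)] := hR.
case; first by split=> //; exists m.
by move=> s [h1 h2]; exists s.
Qed.

(** Only internal sets have suprema, so the infimum of the set [A] of bounds is obtained as the
    supremum of its lower bounds, both sets being internal. The infimum is itself a bound. *)
Lemma opnorm_spec (E : lmodType K) (cE : coding M E) (p : E -> R) (f : E -> K) :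
  is_carrier cE -> internal_fun cE cR p -> (forall x, 0 <= p x) ->
  internal_fun cE cK f ->
  (exists2 m, 0 <= m & forall x, av (f x) <= m * p x) ->
  [/\ 0 <= opnorm av p f, forall x, av (f x) <= opnorm av p f * p x &
    forall m, 0 <= m -> (forall x, av (f x) <= m * p x) -> opnorm av p f <= m].
Proof.
move=> hE hp p0 hf [m0 m00 hm0]; pose EC := CType hE.
pose A := [set m : R | 0 <= m /\ forall x, av (f x) <= m * p x].
have hA : @iset _ RC A.
  apply: iset_and; first by apply: iset_le; [exact: ifun_cst|exact: ifun_id].
  apply: (@iset_all _ RC EC (fun m x => av (f x) <= m * p x)).
  apply: iset_le.
    apply: ifun_av; exact: (@ifun_comp _ EC KC f hf _ _ (@ifun_snd _ RC EC)).
  apply: ifun_mulR; first exact: ifun_fst.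
  exact: (@ifun_comp _ EC RC p hp _ _ (@ifun_snd _ RC EC)).
have hL : @iset _ RC (lbound A).
  apply: (@iset_all _ RC RC (fun r m => A m -> r <= m)).
  apply: iset_imp; first exact: (iset_preim (@ifun_snd _ RC RC) hA).
  by apply: iset_le; [exact: ifun_fst|exact: ifun_snd].
have [s [s1 s2]] : exists s, (forall x, lbound A x -> x <= s) /\
    forall m, (forall x, lbound A x -> x <= m) -> s <= m.
  apply: real_line_sup => //; first by exists 0 => m [].
  by exists m0 => r; apply.
have infs : infimums A s.
  by split=> // m Am; apply: s2 => r; apply.
have -> : opnorm av p f = s.
  (* The default value 0 is excluded because [m0] belongs to [A]; the infimum selected by [xget] is
     [s] by uniqueness. *)
  rewrite /opnorm /infimum ifF; last first.
    by apply/negP => /eqP A0; have : A m0 by []; rewrite /A A0.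
  case: xgetP => [t -> inft|/(_ s)//].
  by apply: (@is_subset1_infimums _ _ A).
have s0 : 0 <= s by apply: s1 => m [].
split=> // [x|m m0' hm]; last exact: (proj1 infs).
(* Where [p x = 0] the factor is irrelevant and [m0] suffices; elsewhere [av (f x) / p x] is a lower
   bound of [A]. *)
have [px0|px] := eqVneq (p x) 0.
  by move: (hm0 x); rewrite px0 !mulr0.
have px1 : 0 < p x by rewrite lt0r px p0.
rewrite -ler_pdivrMr//; apply: s1 => m [_ /(_ x)].
by rewrite ler_pdivrMr.
Qed.

Lemma sub_image (E : lmodType K) (cE : coding M E) (hE : is_carrier cE)
    (P : {pred E}) (F : subLmodType P) :
  is_internal_pred cE P ->
  @iset _ (CType hE) (fun x => exists u : F, x = val u).
Proof.
apply: (@iset_ext _ (CType hE)) => x; split=> [Px|[u ->]]; last exact: (valP u).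
by exists (Sub x Px); rewrite SubK.
Qed.

(** * Ingleton's property for functionals given by graphs *)

Section Graph.
Hypothesis ingleton : Ingleton cR cK av.
Variables (E : lmodType K) (cE : coding M E) (p : E -> R).
Hypothesis hE : is_internal_space cK cE.
Hypothesis hp : is_ultrametric_seminorm cR av cE p.

(** Domination by [p] makes a linear relation single-valued: [G x b] and [G x c] give
    [G 0 (- b + c)], and [p 0 = 0]. It is then a linear form on its domain. *)
Lemma Ingleton_graph (G : E -> K -> Prop) :
  internal_set (pair_coding cE cK) [set z | G z.1 z.2] ->
  G 0 0 ->
  (forall a x b y c, G x b -> G y c -> G (a *: x + y) (a * b + c)) ->
  (forall x b, G x b -> av b <= p x) ->
  exists g : {scalar E}, [/\ internal_fun cE cK g,
    forall x b, G x b -> g x = b & forall x, av (g x) <= p x].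
Proof.
move=> hG G0 Glin Gle.
have cEP : is_carrier cE by case: hE.
pose EC := CType cEP.
have Guniq x b c : G x b -> G x c -> b = c.
  move=> xb xc; have := Glin (-1) _ _ _ _ xb xc.
  rewrite scaleN1r addNr mulN1r => /Gle.
  rewrite (_ : p 0 = 0); last by case: hp => _ [].
  move=> h; have /av0_eq0/eqP : av (- b + c) = 0.
    by apply/le_anti; rewrite h av_ge0.
  by rewrite addrC subr_eq0 => /eqP.
pose S := @Submodule K E (fun x => exists b, G x b) (ex_intro _ 0 G0)
  ltac:(by move=> a x y [b xb] [c yc]; exists (a * b + c); exact: Glin).
(* Since [G] is single-valued, the graph of the chosen [f] is [G] itself, which is internal. *)
have [f hf] := choice (fun u : sm_type S => sm_valP u).
have flin : scalar f.
  move=> a u v; apply: Guniq (hf _) _. rewrite linearP /=.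
  exact: (Glin _ _ _ _ _ (hf u) (hf v)).
pose fL := GRing.isLinear.Build K (sm_type S) K *%R f flin.
pose f' : {scalar sm_type S} := HB.pack f fL.
have hS : is_internal_pred cE (sm_mem S).
  apply: (@iset_ext _ EC (fun x => exists b, G x b)).
    by move=> x; split=> /asboolP.
  by apply: (@iset_ex _ EC KC G).
pose FC := @csub _ EC (sm_type S) val val_inj
  (@sub_image _ _ cEP _ (sm_type S) hS).
have fint : internal_fun (sub_coding cE (F := sm_type S)) cK f'.
  apply/(@ifun_graphP _ FC KC).
  apply: (@iset_ext _ (cprod FC KC) (fun w => G (val w.1) w.2)).
    by move=> [u b] /=; split=> [h|->]; [exact: Guniq h (hf u)|exact: hf].
  apply: (@iset_comp2 _ EC KC G hG (cprod FC KC)); last exact: ifun_snd.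
  apply: (@ifun_comp _ FC EC) (@ifun_fst _ FC KC); exact: ifun_val.
have [g [g1 g2 g3]] := ingleton hE hp hS fint (fun u => Gle _ _ (hf u)).
exists g; split=> // x b xb.
have [u ux] := @sm_mk _ _ S x (ex_intro _ b xb).
rewrite -ux g2 /=; apply: Guniq (hf u) _; by rewrite ux.
Qed.

End Graph.

(** * From linear extenders to Ingleton's property *)

Lemma LinearExtender_Ingleton :
  LinearExtender cR cK av -> Ingleton cR cK av.
Proof.
move=> le E cE p hE hp P F hP f hf hfp.
have [T [_ TBL _ _ Text]] := le E cE p hE hp P F hP.
have cEP : is_carrier cE by case: hE.
have [pint [p0 _] _ _] := hp.
pose EC := CType cEP.
pose FC := @csub _ EC F val val_inj (@sub_image _ _ cEP _ F hP).
have BLf : BL cK av (sub_coding cE (F := F)) (fun x => p (val x)) f.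
  by split=> //; [exact: linearP|exists 1 => // x; rewrite mul1r].
have [ext eqn] := Text f BLf.
have [Tlin Tint Tbd] := TBL f BLf.
have [_ bT _] := opnorm_spec cEP pint p0 Tint Tbd.
have pvint : internal_fun (sub_coding cE (F := F)) cR (fun x => p (val x)).
  exact: (@ifun_comp _ EC RC p pint FC val (ifun_val _ _)).
have [_ _ fle] := opnorm_spec (ccodeP FC) pvint (fun x => p0 _) hf
  ltac:(by case: BLf).
pose gL := GRing.isLinear.Build K E K *%R (T f) Tlin.
pose g : {scalar E} := HB.pack (T f) gL.
exists g; split=> // x; apply: le_trans (bT x) _.
rewrite eqn -[leRHS]mul1r; apply: ler_wpM2r => //.
by apply: fle => // u; rewrite mul1r.
Qed.

(** * From Ingleton's property to linear extenders: near projections onto [F] *)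

Section Extension.
Hypothesis ingleton : Ingleton cR cK av.
Variables (E : lmodType K) (cE : coding M E) (p : E -> R).
Hypothesis hE : is_internal_space cK cE.
Hypothesis hp : is_ultrametric_seminorm cR av cE p.
Variables (P : {pred E}) (F : subLmodType P).
Hypothesis hP : is_internal_pred cE P.

Lemma space_carrier : is_carrier cE. Proof. by case: hE. Qed.
Let EC := CType space_carrier.
Let FC := @csub _ EC F val val_inj (@sub_image _ _ space_carrier _ F hP).

Lemma p_ge0 x : 0 <= p x. Proof. by case: hp => _ []. Qed.
Lemma p0 : p 0 = 0. Proof. by case: hp => _ []. Qed.
Lemma pZ a x : p (a *: x) = av a * p x. Proof. by case: hp. Qed.
Lemma pD x y : p (x + y) <= Num.max (p x) (p y). Proof. by case: hp. Qed.

Lemma p_ker a x y : p x = 0 -> p y = 0 -> p (a *: x + y) = 0.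
Proof.
move=> x0 y0; apply/le_anti; rewrite p_ge0 andbT.
by apply: le_trans (pD _ _) _; rewrite pZ x0 y0 mulr0 maxxx.
Qed.

Lemma p_sub x y : p (x - y) <= Num.max (p x) (p y).
Proof.
have avN1 : av (-1) = 1.
  apply/eqP; rewrite -(@eqrXn2 _ 2) ?av_ge0//.
  by rewrite expr2 -avM mulrNN mulr1 av1 expr1n.
by apply: le_trans (pD _ _) _; rewrite -scaleN1r pZ avN1 mul1r.
Qed.

Lemma ifun_addE (T : ctype M) (f g : T -> EC) :
  ifun f -> ifun g -> @ifun _ T EC (fun t => f t + g t).
Proof.
have h : @ifun _ (cprod EC EC) EC (fun z => z.1 + z.2) by case: hE.
exact: (@ifun_comp2 _ EC EC EC (fun x y => x + y) h).
Qed.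

Lemma ifun_scaleE (T : ctype M) (f : T -> KC) (g : T -> EC) :
  ifun f -> ifun g -> @ifun _ T EC (fun t => f t *: g t).
Proof.
have h : @ifun _ (cprod KC EC) EC (fun z => z.1 *: z.2) by case: hE.
exact: (@ifun_comp2 _ KC EC EC (fun x y => x *: y) h).
Qed.

Lemma ifun_subE (T : ctype M) (f g : T -> EC) :
  ifun f -> ifun g -> @ifun _ T EC (fun t => f t - g t).
Proof.
move=> hf hg; under eq_fun do rewrite -scaleN1r.
by apply: ifun_addE => //; apply: ifun_scaleE => //; exact: ifun_cst.
Qed.

Lemma ifun_p (T : ctype M) (f : T -> EC) :
  ifun f -> @ifun _ T RC (fun t => p (f t)).
Proof. by apply: (@ifun_comp _ EC RC p); case: hp. Qed.

Lemma ifun_valF (T : ctype M) (f : T -> FC) :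
  ifun f -> @ifun _ T EC (fun t => val (f t)).
Proof. by apply: (@ifun_comp _ FC EC val); exact: ifun_val. Qed.

Lemma ifun_val_app (T : ctype M) (f : T -> cfun EC FC) (g : T -> EC) :
  ifun f -> ifun g -> @ifun _ T EC (fun t => val (sval (f t) (g t))).
Proof. by move=> hf hg; apply: ifun_valF; exact: ifun_app. Qed.

Ltac ifun_op ::= first
  [ apply: ifun_av | apply: ifun_mulR | apply: ifun_addK | apply: ifun_mulK
  | apply: ifun_p | apply: ifun_val_app | apply: ifun_valF
  | apply: ifun_subE | apply: ifun_addE | apply: ifun_scaleE ].

(** Idempotence holds up to vectors of semi-norm 0, on which every bounded linear form vanishes. *)
Definition near_projection (Q : E -> F) : Prop :=
  [/\ forall a x y, val (Q (a *: x + y)) = a *: val (Q x) + val (Q y),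
      forall x, p (val (Q x)) <= p x &
      forall x, p (val (Q (val (Q x))) - val (Q x)) = 0].

(** Only internal maps are taken, so that the near projections form a set of the model. *)
Definition proj : Type := {Q : cfun EC FC | near_projection (sval Q)}.

Definition papp (Q : proj) : E -> F := sval (sval Q).

Lemma papp_lin Q a x y :
  val (papp Q (a *: x + y)) = a *: val (papp Q x) + val (papp Q y).
Proof. by have [h _ _] := svalP Q; apply: h. Qed.

Lemma papp_le Q x : p (val (papp Q x)) <= p x.
Proof. by have [_ h _] := svalP Q; apply: h. Qed.

Lemma papp_idem Q x : p (val (papp Q (val (papp Q x))) - val (papp Q x)) = 0.
Proof. by have [_ _ h] := svalP Q; apply: h. Qed.

Lemma proj_mk (Q : E -> F) : @ifun _ EC EC (fun x => val (Q x)) ->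
  near_projection Q -> exists Q' : proj, papp Q' = Q.
Proof.
move=> Qi Qn; have Qi' : @ifun _ EC FC Q by exact: ifun_sub.
by exists (exist _ (exist _ Q Qi') Qn).
Qed.

Lemma proj_image :
  @iset _ (cfun EC FC) (fun Q => exists Q' : proj, Q = sval Q').
Proof.
apply: (@iset_ext _ (cfun EC FC) (fun Q =>
    (forall a x y,
       val (sval Q (a *: x + y)) = a *: val (sval Q x) + val (sval Q y)) /\
    ((forall x, p (val (sval Q x)) <= p x) /\
     (forall x, p (val (sval Q (val (sval Q x))) - val (sval Q x)) = 0)))).
  move=> Q; split=> [[h1 [h2 h3]]|[[Q' [h1 h2 h3]] ->//]].
  by exists (exist _ Q (And3 h1 h2 h3)).
apply: iset_and.
  apply: (@iset_all _ _ KC); do 2!apply: (@iset_all _ _ EC).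
  apply: (@iset_eq _ _ EC).
    solve_ifun.
  solve_ifun.
apply: iset_and; apply: (@iset_all _ _ EC).
  apply: iset_le; solve_ifun.
apply: (@iset_eq _ _ RC).
  solve_ifun.
exact: ifun_cst.
Qed.

Let PC := @csub _ (cfun EC FC) proj sval (@sval_inj _ _) proj_image.

Lemma ifun_papp (T : ctype M) (f : T -> PC) (g : T -> EC) :
  ifun f -> ifun g -> @ifun _ T FC (fun t => papp (f t) (g t)).
Proof.
move=> hf hg; apply: (@ifun_app _ EC FC T (fun t => sval (f t))) => //.
by apply: (@ifun_comp _ PC (cfun EC FC) sval) => //; exact: ifun_val.
Qed.

Definition fixes (Q : proj) (y : F) : Prop :=
  p (val (papp Q (val y)) - val y) = 0.

Definition proj_le (Q Q' : proj) : Prop := forall y, fixes Q y -> fixes Q' y.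

Lemma proj_inhabited : exists Q : proj, True.
Proof.
have h : near_projection (fun=> 0 : F).
  by split=> [a x y|x|x]; rewrite ?linear0 ?scaler0 ?addr0 ?subr0 ?p0 ?p_ge0.
have [|Q _] := proj_mk _ h; last by exists Q.
exact: (@ifun_cst _ EC EC).
Qed.

(** Ingleton's property for the form [b *: z |-> b] on the line of [z], with the rescaled semi-norm
    [p / p z], whose value at [b *: z] is exactly [av b]. *)
Lemma coordinate_functional (z : E) : p z != 0 ->
  exists psi : {scalar E}, [/\ @ifun _ EC KC psi, psi z = 1 &
    forall x, av (psi x) * p z <= p x].
Proof.
move=> pz0; have pz : 0 < p z by rewrite lt0r pz0 p_ge0.
have hq : is_ultrametric_seminorm cR av cE (fun x => p x * (p z)^-1).
  split.
  - by apply: (@ifun_mulR EC p (fun=> (p z)^-1)); solve_ifun.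
  - by split=> [x|]; rewrite ?p0 ?mul0r// mulr_ge0 ?p_ge0 ?invr_ge0 ?p_ge0.
  - by move=> a x; rewrite pZ mulrA.
  - by move=> x y; rewrite -maxr_pMl ?invr_ge0 ?p_ge0// ler_pM2r ?invr_gt0 ?pD.
have [||||psi [psi1 psi2 psi3]] :=
    Ingleton_graph ingleton hE hq (G := fun x b => x = b *: z).
- by apply: (@iset_eq _ (cprod EC KC) EC); solve_ifun.
- by rewrite scale0r.
- by move=> a x b y c -> ->; rewrite scalerDl scalerA.
- by move=> x b ->; rewrite pZ mulfK.
exists psi; split=> // [|x]; first by apply: psi2; rewrite scale1r.
by rewrite -ler_pdivlMr.
Qed.

(** Take [Q' x = Q x + phi x *: y'] with [y' = y - Q y] and [phi x = psi (x - Q x)], where [psi] is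
    the coordinate form of [y']. Then [phi] vanishes on what [Q] fixes, and [phi y = 1] adds the
    missing part [y'] of [y]. *)
Lemma proj_extend (Q : proj) (y : F) :
  exists2 Q' : proj, proj_le Q Q' & fixes Q' y.
Proof.
pose y' : F := y - papp Q (val y).
have y'E : val y' = val y - val (papp Q (val y)) by rewrite linearB.
have p_opp x z : p (x - z) = 0 -> p (z - x) = 0.
  by move=> h; rewrite -opprB -scaleN1r pZ h mulr0.
have [y'0|y'N0] := eqVneq (p (val y')) 0.
  (* Here [Q] already fixes [y]. *)
  by exists Q => //; apply: p_opp; rewrite -y'E.
have y'p : 0 < p (val y') by rewrite lt0r y'N0 p_ge0.
have [psi [psi_int psi1 psi_le]] := coordinate_functional y'N0.
have psi_ker z : p z = 0 -> psi z = 0.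
  move=> z0; apply: av0_eq0; apply/le_anti; rewrite av_ge0 andbT.
  by rewrite -(pmulr_lle0 _ y'p) -z0.
pose phi x := psi (x - val (papp Q x)).
pose Q' x : F := papp Q x + phi x *: y'.
have Q'E x : val (Q' x) = val (papp Q x) + phi x *: val y'.
  by rewrite /Q' addrC linearP addrC.
have phi_lin a x z : phi (a *: x + z) = a * phi x + phi z.
  rewrite /phi papp_lin opprD addrACA -scalerBr.
  by rewrite linearP.
(* The ultrametric inequality gives [p (x - Q x) <= p x], without a factor 2, so that [Q'] keeps
   norm at most 1. *)
have phi_le x : av (phi x) * p (val y') <= p x.
  apply: le_trans (psi_le _) _; apply: le_trans (p_sub _ _) _.
  by rewrite ge_max lexx papp_le.
have phi_val u : fixes Q u -> phi (val u) = 0.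
  by move=> hu; apply: psi_ker; exact: p_opp.
have Qy' : p (val (papp Q (val y'))) = 0.
  rewrite y'E addrC -scaleN1r papp_lin scaleN1r addrC.
  by apply: p_opp; exact: papp_idem.
have phi_y' : phi (val y') = 1.
  by rewrite /phi linearB psi1 psi_ker// subr0.
have phi_y : phi (val y) = 1 by rewrite /phi -y'E.
have Q'n : near_projection Q'.
  split=> [a x z|x|x].
  - rewrite !Q'E papp_lin phi_lin scalerDr scalerDl scalerA.
    by rewrite addrACA.
  - rewrite Q'E; apply: le_trans (pD _ _) _.
    by rewrite ge_max papp_le pZ phi_le.
  (* Because [phi (Q x) = 0] and [phi y' = 1]. The terms in [y'] then cancel, leaving
     [(Q (Q x) - Q x) + phi x *: Q y'], both parts of semi-norm 0. *)
  - have phiQ : phi (val (Q' x)) = phi x.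
      rewrite Q'E addrC phi_lin phi_y' mulr1 phi_val ?addr0//.
      exact: papp_idem.
    rewrite [X in X - _]Q'E phiQ Q'E opprD addrACA subrr addr0.
    rewrite addrC (addrC (val (papp Q x))) papp_lin addrCA.
    apply: p_ker => //; rewrite addrC; exact: papp_idem.
have [|R' R'E] := proj_mk _ Q'n.
  under eq_fun do rewrite Q'E.
  have hQ : @ifun _ EC FC (papp Q) by exact: (svalP (sval Q)).
  have hphi : @ifun _ EC KC phi.
    apply: (@ifun_comp _ EC KC psi) => //.
    apply: ifun_subE; first exact: ifun_id.
    exact: ifun_valF.
  apply: ifun_addE; first exact: ifun_valF.
  by apply: ifun_scaleE => //; exact: ifun_cst.
exists R' => [u hu|]; rewrite /fixes R'E Q'E.
  by rewrite phi_val// scale0r addr0.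
by rewrite phi_y scale1r y'E addrCA subrr addr0 subrr p0.
Qed.

(** * The space of bounded functions of a near projection and a generalized limit on it *)

Definition bounded_ifun (w : proj -> K^o) : Prop :=
  @ifun _ PC KC w /\ exists m, forall Q, av (w Q) <= m.

Lemma bounded_0 : bounded_ifun 0.
Proof. by split; [exact: ifun_cst|exists 0 => Q; rewrite av0]. Qed.

Lemma bounded_lin (a : K) (w w' : proj -> K^o) :
  bounded_ifun w -> bounded_ifun w' -> bounded_ifun (a *: w + w').
Proof.
move=> [wi [m hm]] [wi' [m' hm']]; split.
  by apply: ifun_addK => //; apply: ifun_mulK => //; exact: ifun_cst.
exists (Num.max (av a * m) m') => Q; apply: le_trans (avD _ _) _.
by rewrite ge_max !le_max avM ler_wpM2l ?av_ge0//= hm' orbT.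
Qed.

Definition bounded : submodule (proj -> K^o) :=
  Submodule bounded_0 bounded_lin.
Let B : lmodType K := sm_type bounded.

Definition bounded_fun (w : B) : cfun PC KC :=
  exist _ (val w) (proj1 (sm_valP w)).

Lemma bounded_valE (a : K) (w w' : B) Q : (val (a *: w + w') : proj -> K) Q =
  a * (val w : proj -> K) Q + (val w' : proj -> K) Q.
Proof. by rewrite linearP. Qed.

Lemma bounded_fun_inj : injective bounded_fun.
Proof. by move=> w w' [] /val_inj. Qed.

Lemma bounded_fun_image :
  @iset _ (cfun PC KC) (fun g => exists w : B, g = bounded_fun w).
Proof.
apply: (@iset_ext _ (cfun PC KC) (fun g =>
    exists m, forall Q, av (sval g Q) <= m)).
  move=> g; split=> [hg|[w ->]]; last by case: (sm_valP w).
  have [|w we] := @sm_mk _ _ bounded (sval g).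
    by split=> //; exact: (svalP g).
  by exists w; apply: sval_inj; rewrite /= we.
apply: (@iset_ex _ _ RC); apply: (@iset_all _ _ PC).
apply: iset_le; last by solve_ifun.
apply: ifun_av; apply: ifun_app; solve_ifun.
Qed.

Let BC := @csub _ (cfun PC KC) B bounded_fun bounded_fun_inj bounded_fun_image.

Lemma ifun_bounded_app (T : ctype M) (f : T -> BC) (g : T -> PC) :
  ifun f -> ifun g -> @ifun _ T KC (fun t => (val (f t) : proj -> K) (g t)).
Proof.
move=> hf hg; apply: (@ifun_app _ PC KC T (fun t => bounded_fun (f t))) => //.
by apply: (@ifun_comp _ BC (cfun PC KC) bounded_fun) => //; exact: ifun_val.
Qed.

Lemma ifun_bounded_lam (T : ctype M) (f : T -> BC) :
  @ifun _ (cprod T PC) KC (fun z => (val (f z.1) : proj -> K) z.2) -> ifun f.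
Proof.
move=> h; apply: ifun_sub.
exact: (@ifun_lam _ PC KC T (fun t => bounded_fun (f t))).
Qed.

Lemma bounded_space : is_internal_space cK (@ccode _ BC).
Proof.
(* Addition is the case [a = 1] and scaling the case [g = 0]; currying reduces internality to
   pointwise operations in [K]. *)
have h (T : ctype M) (a : T -> KC) (f g : T -> BC) : ifun a -> ifun f ->
    ifun g -> @ifun _ T BC (fun t => a t *: (f t : B) + g t).
  move=> ha hf hg; apply: ifun_bounded_lam.
  under eq_fun do rewrite bounded_valE.
  have h1 : @ifun _ (cprod T PC) T (fun z => z.1) by solve_ifun.
  apply: ifun_addK.
    apply: ifun_mulK; first exact: (ifun_comp ha h1).
    by apply: ifun_bounded_app; [exact: (ifun_comp hf h1)|solve_ifun].
  by apply: ifun_bounded_app; [exact: (ifun_comp hg h1)|solve_ifun].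
split; first exact: (ccodeP BC).
- rewrite /internal_op (_ : (fun z => _) = fun z : B * B => 1 *: z.1 + z.2).
    by apply: (h (cprod BC BC) (fun=> 1) fst snd); solve_ifun.
  by apply/funext => z; rewrite scale1r.
- rewrite /internal_op (_ : (fun z => _) = fun z : K * B => z.1 *: z.2 + 0).
    by apply: (h (cprod KC BC) fst snd (fun=> 0)); solve_ifun.
  by apply/funext => z; rewrite addr0.
Qed.

(** The supremum norm, chosen outside the model. The two properties determine [q], and its
    internality is later read off from them. *)
Lemma sup_norm_exists : exists q : B -> R,
  (forall w Q, av ((val w : proj -> K) Q) <= q w) /\
  (forall w m, (forall Q, av ((val w : proj -> K) Q) <= m) -> q w <= m).
Proof.
have [Q0 _] := proj_inhabited.
have key (w : B) : exists s, (forall Q, av ((val w : proj -> K) Q) <= s) /\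
    forall m, (forall Q, av ((val w : proj -> K) Q) <= m) -> s <= m.
  have [|||s [s1 s2]] :=
      @real_line_sup (fun r => exists Q, r = av ((val w : proj -> K) Q)).
  - apply: (@iset_ex _ RC PC); apply: (@iset_eq _ _ RC); first exact: ifun_fst.
    by apply: ifun_av; apply: ifun_bounded_app; solve_ifun.
  - by exists (av ((val w : proj -> K) Q0)), Q0.
  - have [_ [m hm]] := sm_valP w; exists m => _ [Q ->]; exact: hm.
  exists s; split=> [Q|m hm]; first by apply: s1; exists Q.
  by apply: s2 => _ [Q ->].
have [q hq] := choice key.
by exists q; split=> w; have [] := hq w.
Qed.

(* [w] takes the value [c] on a dense open set of near projections; such sets
   form a filter, so that [c] is determined by [w]. *)
Definition eventually_eq (w : B) (c : K) : Prop :=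
  forall Q, exists Q', proj_le Q Q' /\
    forall Q'', proj_le Q' Q'' -> (val w : proj -> K) Q'' = c.

(** Ingleton's property is applied to the supremum norm and to the graph [eventually_eq], the limit
    of eventually constant functions. *)
Lemma generalized_limit : exists L : {scalar B},
  [/\ @ifun _ BC KC L,
    forall w c, eventually_eq w c -> L w = c &
    forall w m, (forall Q, av ((val w : proj -> K) Q) <= m) -> av (L w) <= m].
Proof.
have [Q0 _] := proj_inhabited.
have [q [q1 q2]] := sup_norm_exists.
have q0 w : 0 <= q w by apply: le_trans (q1 w Q0); exact: av_ge0.
have qle0 : q 0 = 0.
  by apply/le_anti; rewrite q0 andbT; apply: q2 => Q; rewrite av0.
have qlin a w w' : q (a *: w + w') <= Num.max (av a * q w) (q w').
  apply: q2 => Q; rewrite bounded_valE; apply: le_trans (avD _ _) _.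
  by rewrite ge_max !le_max avM ler_wpM2l ?av_ge0 ?q1 ?orbT.
have qZ_le a w : q (a *: w) <= av a * q w.
  have := qlin a w 0; rewrite addr0 qle0 => /le_trans; apply.
  by rewrite ge_max lexx mulr_ge0 ?av_ge0.
have hq : is_ultrametric_seminorm cR av (@ccode _ BC) q.
  split=> //.
  - apply/(@ifun_graphP _ BC RC).
    apply: (@iset_ext _ (cprod BC RC) (fun z =>
        (forall Q, av ((val z.1 : proj -> K) Q) <= z.2) /\
        (forall m, (forall Q, av ((val z.1 : proj -> K) Q) <= m) -> z.2 <= m))).
      move=> [w r] /=.
      split=> [[r1 r2]|->]; last by split; [exact: q1|exact: q2].
      by apply/le_anti/andP; split; [exact: r2 _ (q1 w)|exact: q2 _ _ r1].
    apply: iset_and.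
      apply: (@iset_all _ _ PC); apply: iset_le; last by solve_ifun.
      by apply: ifun_av; apply: ifun_bounded_app; solve_ifun.
    apply: (@iset_all _ _ RC); apply: iset_imp; last first.
      by apply: iset_le; solve_ifun.
    apply: (@iset_all _ _ PC); apply: iset_le; last by solve_ifun.
    by apply: ifun_av; apply: ifun_bounded_app; solve_ifun.
  - move=> a w; apply/le_anti; rewrite qZ_le /=.
    have [->|a0] := eqVneq a 0; first by rewrite av0 mul0r q0.
    have ap : 0 < av a.
      by rewrite lt0r av_ge0 andbT; apply: contra a0 => /eqP/av0_eq0 ->.
    (* The reverse inequality is [qZ_le] applied to [a^-1] and [a *: w]. *)
    rewrite -ler_pdivlMl//; apply: le_trans (_ : q (a^-1 *: (a *: w)) <= _).
      by rewrite scalerA mulVf// scale1r.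
    apply: le_trans (qZ_le _ _) _; rewrite ler_wpM2r//.
    by rewrite -[leRHS]mulr1 ler_pdivlMl// -avM mulfV// av1.
  - move=> w w'; have := qlin 1 w w'.
    by rewrite scale1r av1 mul1r.
have [||||L [L1 L2 L3]] :=
    Ingleton_graph ingleton bounded_space hq (G := eventually_eq).
- change (@iset _ (cprod BC KC) (fun z => eventually_eq z.1 z.2)).
  apply: (@iset_all _ (cprod BC KC) PC); apply: (@iset_ex _ _ PC).
  have hle (T : ctype M) (f g : T -> PC) : ifun f -> ifun g ->
      iset (fun t => proj_le (f t) (g t)).
    move=> hf hg; apply: (@iset_all _ T FC).
    have hfix (f' : T -> PC) : ifun f' ->
        @iset _ (cprod T FC) (fun z => fixes (f' z.1) z.2).
      move=> hf'; apply: (@iset_eq _ _ RC); last exact: ifun_cst.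
      apply: ifun_p; apply: ifun_subE; last by solve_ifun.
      apply: ifun_valF; apply: ifun_papp; last by solve_ifun.
      by apply: (@ifun_comp _ T PC); solve_ifun.
    by apply: iset_imp; exact: hfix.
  apply: iset_and; first by apply: hle; solve_ifun.
  apply: (@iset_all _ _ PC); apply: iset_imp; first by apply: hle; solve_ifun.
  apply: (@iset_eq _ _ KC); last by solve_ifun.
  by apply: ifun_bounded_app; solve_ifun.
- by move=> Q; exists Q; split.
- move=> a w b w' c wb wc Q.
  (* The second witness is sought above the first, so that both functions are constant above
     [Q2]. *)
  have [Q1 [QQ1 h1]] := wb Q; have [Q2 [Q12 h2]] := wc Q1.
  exists Q2; split=> [y /QQ1 /Q12//|Q3 Q23].
  by rewrite bounded_valE h1 ?h2// => y /Q12 /Q23.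
(* The limit [b] is a value actually taken by [w], hence bounded by the supremum norm. *)
- move=> w b wb; have [Q [_ h]] := wb Q0.
  by rewrite -(h Q)// q1.
exists L; split=> // w m hm; apply: le_trans (L3 w) _; exact: q2.
Qed.

(** * Bounded linear forms on [F] and the isometric extender *)

Let pF : F -> R := fun y => p (val y).
Let BLF : set (F -> K) := BL cK av (@ccode _ FC) pF.

Lemma ifun_pF : @ifun _ FC RC pF.
Proof. by apply: ifun_p; apply: ifun_valF; exact: ifun_id. Qed.

Lemma BL_opnorm f : BLF f -> [/\ 0 <= opnorm av pF f,
  forall y, av (f y) <= opnorm av pF f * pF y &
  forall m, 0 <= m -> (forall y, av (f y) <= m * pF y) -> opnorm av pF f <= m].
Proof.
move=> [_ fint bd].
exact: (opnorm_spec (ccodeP FC) ifun_pF (fun y => p_ge0 _) fint bd).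
Qed.

Lemma BL_lin a f g : BLF f -> BLF g -> BLF (fun y => a * f y + g y).
Proof.
move=> [flin fint [m m0 hm]] [glin gint [m' m'0 hm']]; split.
- move=> b x y; rewrite flin glin mulrDr mulrDr addrACA; congr (_ + _ + _).
  by rewrite !mulrA (mulrC a).
- apply: (@ifun_addK FC); last exact: gint.
  by apply: (@ifun_mulK FC) fint; exact: ifun_cst.
exists (Num.max (av a * m) m').
  by rewrite le_max m'0 orbT.
move=> y; apply: le_trans (avD _ _) _.
rewrite maxr_pMl ?p_ge0// ge_max !le_max avM -mulrA.
by rewrite ler_wpM2l ?av_ge0 ?hm ?hm' ?orbT.
Qed.

Lemma BL_image : @iset _ (cfun FC KC)
  (fun f => exists g : {f : cfun FC KC | BLF (sval f)}, f = sval g).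
Proof.
apply: (@iset_ext _ (cfun FC KC) (fun f =>
    (forall a x y, sval f (a *: (x : F) + y) = a * sval f x + sval f y) /\
    (exists m, 0 <= m /\ forall x, av (sval f x) <= m * pF x))).
  move=> f; split=> [[h1 [m [h2 h3]]]|[[g [h1 h2 [m h3 h4]]] ->]]; last first.
    by split=> //; exists m.
  have fB : BLF (sval f) by split; [|exact: (svalP f)|exists m].
  by exists (exist _ f fB).
apply: iset_and.
  apply: (@iset_all _ _ KC); do 2!apply: (@iset_all _ _ FC).
  apply: (@iset_eq _ _ KC).
    apply: (@ifun_app _ FC KC); first by solve_ifun.
    apply: ifun_sub; under eq_fun do rewrite linearP.
    by solve_ifun.
  apply: ifun_addK; last by apply: (@ifun_app _ FC KC); solve_ifun.
  apply: ifun_mulK; first by solve_ifun.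
  by apply: (@ifun_app _ FC KC); solve_ifun.
apply: (@iset_ex _ _ RC); apply: iset_and.
  by apply: iset_le; solve_ifun.
apply: (@iset_all _ _ FC); apply: iset_le.
  by apply: ifun_av; apply: (@ifun_app _ FC KC); solve_ifun.
apply: ifun_mulR; first by solve_ifun.
by apply: (ifun_comp ifun_pF); solve_ifun.
Qed.

Let BLC := @csub _ (cfun FC KC) _ sval (@sval_inj _ _) BL_image.

Lemma isometric_extender_exists :
  exists T : (F -> K) -> (E -> K), is_isometric_linear_extender cK av cE p T.
Proof.
have [L [Lint L2 L3]] := generalized_limit.
(* For [z = (f, x)], the function [Q |-> f (Q x)] as an element of [B]; nothing is required when [f]
   is not bounded linear. *)
have key (z : (F -> K) * E) : exists w : B, BLF z.1 ->
    forall Q, (val w : proj -> K) Q = z.1 (papp Q z.2).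
  have [zB|zB] := pselect (BLF z.1); last by exists 0.
  have [N0 bd _] := BL_opnorm zB.
  have [|w we] := @sm_mk _ _ bounded (fun Q => z.1 (papp Q z.2)); last first.
    by exists w => _ Q; rewrite we.
  split; last first.
    exists (opnorm av pF z.1 * p z.2) => Q; apply: le_trans (bd _) _.
    by rewrite ler_wpM2l// papp_le.
  case: zB => _ zint _; apply: (@ifun_comp _ FC KC z.1 zint).
  by apply: ifun_papp; [exact: ifun_id|exact: ifun_cst].
have [W hW] := choice key.
have Weq w w' : (forall Q, (val w : proj -> K) Q = (val w' : proj -> K) Q) ->
    w = w' :> B.
  by move=> h; apply: val_inj; exact/funext.
pose T (f : F -> K) (x : E) : K := L (W (f, x)).
have Tlin a f g : BLF f -> BLF g ->
    T (fun y => a * f y + g y) = fun x => a * T f x + T g x.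
  move=> hf hg; apply/funext => x; rewrite /T -linearP; congr (L _).
  by apply: Weq => Q; rewrite bounded_valE !hW//; exact: BL_lin.
have Tle f x : BLF f -> av (T f x) <= opnorm av pF f * p x.
  move=> hf; apply: L3 => Q; rewrite hW//.
  have [N0 bd _] := BL_opnorm hf; apply: le_trans (bd _) _.
  by rewrite ler_wpM2l// papp_le.
(* [W] comes from an external choice, but over [BLC] its values are prescribed by [hW]; uncurrying
   in [Q] leaves an evaluation. *)
have Wint : @ifun _ (cprod BLC EC) BC (fun z => W (sval (sval z.1), z.2)).
  apply: ifun_bounded_lam.
  under eq_fun => z do rewrite (hW (sval (sval z.1.1), z.1.2) (svalP z.1.1)).
  apply: (@ifun_app _ FC KC (cprod (cprod BLC EC) PC) (fun z => sval z.1.1)).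
    apply: (@ifun_comp _ BLC (cfun FC KC) sval); first exact: ifun_val.
    by solve_ifun.
  by apply: ifun_papp; solve_ifun.
have Tint2 : @ifun _ (cprod BLC EC) KC (fun z => T (sval (sval z.1)) z.2).
  exact: (ifun_comp Lint Wint).
pose Bmk f (hf : BLF f) : BLC :=
  exist _ (exist _ f (let: And3 _ h _ := hf in h)) hf.
have Tint f : BLF f -> @ifun _ EC KC (T f).
  move=> hf; apply: (@ifun_comp _ _ KC _ Tint2 EC (fun x => (Bmk f hf, x))).
  by apply: ifun_pair; solve_ifun.
have TB f : BLF f -> BL cK av cE p (T f).
  move=> hf; split; [|exact: Tint|]; last first.
    by exists (opnorm av pF f) => [|x]; [case: (BL_opnorm hf)|exact: Tle].
  move=> a x y; rewrite /T -linearP; congr (L _).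
  apply: Weq => Q; rewrite bounded_valE !hW//=.
  have -> : papp Q (a *: x + y) = a *: papp Q x + papp Q y.
    by apply: val_inj; rewrite papp_lin linearP.
  by case: hf => ->.
have Text f y : BLF f -> T f (val y) = f y.
  move=> hf; apply: L2 => Q; have [Q' QQ' Q'y] := proj_extend Q y.
  (* Every [Q''] above [Q'] still fixes [y] up to semi-norm 0, and the bounded form [f] does not see
     the difference. *)
  exists Q'; split=> // Q'' /(_ _ Q'y) Q''y; rewrite hW//=.
  apply/eqP; rewrite -subr_eq0; apply/eqP/av0_eq0/le_anti.
  rewrite av_ge0 andbT; have [_ bd _] := BL_opnorm hf.
  have [flin _ _] := hf.
  have -> : f (papp Q'' (val y)) - f y = f (papp Q'' (val y) - y).
    by rewrite -mulN1r addrC -flin scaleN1r addrC.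
  by apply: le_trans (bd _) _; rewrite /pF linearB Q''y mulr0.
have Tnorm f : BLF f -> opnorm av p (T f) = opnorm av pF f.
  move=> hf; have [_ _ bd] := TB f hf.
  have pint : internal_fun cE cR p by case: hp.
  have [N0 Tbd Tmin] := opnorm_spec space_carrier pint p_ge0 (Tint f hf) bd.
  have [n0 _ fmin] := BL_opnorm hf.
  apply/le_anti/andP; split; first by apply: Tmin => // x; exact: Tle.
  (* As [T f] extends [f], a bound for [T f] is a bound for [f]. *)
  by apply: fmin => // y; rewrite -(Text f y hf).
exists T; split=> //.
(* The graph of [T] is internal as that of a map between the carriers [BLC] and [cfun EC KC]; the
   same set [v] codes the graph on raw functions. *)
- pose Tc (f : BLC) : cfun EC KC :=
    exist _ (T (sval (sval f))) (Tint _ (svalP f)).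
  have [v [v1 v2]] : @ifun _ BLC (cfun EC KC) Tc by apply: ifun_lam.
  exists v; split.
    move=> _ [f hf <-].
    have [|a fa a_v] := v1 (Bmk f hf, Tc (Bmk f hf)); last by exists a.
    by exists (Bmk f hf).
  move=> a /v2 [_ [f _ <-] fa].
  exists (sval (sval f), T (sval (sval f))) => //.
  by exists (sval (sval f)) => //; exact: (svalP f).
(* By linearity and isometry [T g - T f = T (g - f)] has the norm of [g - f], so [d = e] works. *)
- move=> f hf e e0; exists e => // g hg.
  have sub_lin (A : Type) (u w : A -> K) : u \- w = fun x => -1 * w x + u x.
    by apply/funext => x /=; rewrite mulN1r addrC.
  have hgf : BLF (g \- f) by rewrite sub_lin; exact: BL_lin.
  by rewrite (_ : T g \- T f = T (g \- f)) ?Tnorm// !sub_lin Tlin.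
- by move=> f hf; split=> [y|]; [exact: Text|exact: Tnorm].
Qed.

End Extension.

Lemma Ingleton_LinearExtender :
  Ingleton cR cK av -> LinearExtender cR cK av.
Proof.
move=> ingleton E cE p hE hp P F hP.
exact: isometric_extender_exists ingleton _ _ _ hE hp _ F hP.
Qed.

End ValuedField.

Theorem theorem2 (M : zf_model)
    (R : realFieldType) (cR : coding M R)
    (K : fieldType) (cK : coding M K) (av : K -> R) :
  is_real_line cR ->
  is_ultrametric_valued_field cR cK av ->
  spherically_complete cK av ->
  (Ingleton cR cK av <-> LinearExtender cR cK av).
Proof.
move=> hR hK _; split; first exact: Ingleton_LinearExtender.
exact: LinearExtender_Ingleton.
Qed.
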